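(* Let $r\geq 1$, $d\geq 2$ and $g\geq 4$ be integers. Let $u(d,r)$ denote the unique positive real number satisfying $$\sum_{n\ge 0}\binom{n+d-2}{d-2}\frac{u(d,r)^{rn+1}}{rn+1}=1,$$ and set $$f(d,r)=u(d,r)-\frac{u(d,r)^{r+1}}{r+1},\qquad \epsilon(g,d,r)=\frac{d(d-1)^{\lfloor\frac{g-3}{2}\rfloor}}{r\prod_{k=1}^{\lfloor\frac{g-1}{2}\rfloor}\left(k+\frac{1}{r}\right)}.$$ Let $G$ be an $(r+1)$-uniform $d$-regular hypergraph on $n$ vertices with girth $g$, and let $\mathcal{I}$ be the independent set of $G$ produced by the randomized greedy algorithm. Then $$(f(d,r)-\epsilon(g,d,r))\,n\le \mathbb{E}[|\mathcal{I}|]\le (f(d,r)+\epsilon(g,d,r))\,n .$$ In particular $\alpha(G)\ge (f(d,r)-\epsilon(g,d,r))n$.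
   Context: A hypergraph is a pair $(V,E)$ with $V$ a finite set and $E$ a family of nonempty subsets of $V$ (edges); it is $(r+1)$-uniform if every edge has size $r+1$, and $d$-regular if every vertex lies in exactly $d$ edges. An independent set is a subset of $V$ containing no edge; $\alpha(G)$ is the maximum size of an independent set. For $k\ge 3$, a Berge $k$-cycle consists of $k$ distinct edges $e_1,\dots,e_k$ and distinct vertices $v_1,\dots,v_k$ with $v_k,v_1\in e_1$, $v_1,v_2\in e_2$, $\dots$, $v_{k-1},v_k\in e_k$; a Berge 2-cycle consists of two distinct edges $e_1,e_2$ and two distinct vertices $v_1,v_2\in e_1\cap e_2$. The girth of a hypergraph is the smallest $k$ such that it contains a Berge $k$-cycle. The randomized greedy algorithm: maintain a set $S$ of selected vertices (initially empty) and a set $R$ of remaining vertices (initially $V$); while $R\neq\emptyset$, choose a vertex $v\in R$ uniformly at random, add $v$ to $S$, remove $v$ from $R$, and remove from $R$ every vertex $w$ for which some edge $e$ satisfies $e\subseteq S\cup\{w\}$. The output $\mathcal{I}=S$ is an independent set. *)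

(* Defs.v *)
From mathcomp Require Import all_boot all_order all_algebra.

Set Implicit Arguments.
Unset Strict Implicit.
Unset Printing Implicit Defensive.

Import Order.TTheory GRing.Theory Num.Theory.

Record hypergraph := Hypergraph {
  vertex : finType;
  edges : {set {set vertex}};
  edges_nonempty : set0 \notin edges
}.

Section Combinatorics.
Variable G : hypergraph.
Local Notation V := (vertex G).

Definition uniform (k : nat) : Prop :=
  forall e : {set V}, e \in edges G -> #|e| = k.

Definition regular (d : nat) : Prop :=
  forall v : V, #|[set e in edges G | v \in e]| = d.

Definition independent (S : {set V}) : bool :=
  ~~ [exists e in edges G, e \subset S].

Definition alpha : nat := \max_(S : {set V} | independent S) #|S|.

(* [ord_pred] is the cyclic predecessor on ['I_k]. For [k = 2] the condition
   says exactly that two distinct vertices lie in both of two distinct edges. *)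
Definition berge_cycle (k : nat) (e : 'I_k -> {set V}) (v : 'I_k -> V) : Prop :=
  [/\ 2 <= k, injective e, injective v
    & forall i, [/\ e i \in edges G, v (ord_pred i) \in e i & v i \in e i]].

Definition has_berge_cycle (k : nat) : Prop :=
  exists e v, @berge_cycle k e v.

Definition has_girth (g : nat) : Prop :=
  has_berge_cycle g /\ forall k, has_berge_cycle k -> g <= k.

Definition greedy_next (S Q : {set V}) (v : V) : {set V} :=
  [set w in Q :\ v | ~~ [exists e in edges G, e \subset w |: (v |: S)]].

End Combinatorics.

Local Open Scope ring_scope.

Section Greedy.
Variables (R : realFieldType) (G : hypergraph).
Local Notation V := (vertex G).

(* Probability that the algorithm, started with selected set [S] and remaining
   set [Q], outputs [I]. The counter [m] only ensures termination: [Q] shrinks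
   at each step, so its value is irrelevant as soon as [#|Q| <= m]; see
   [greedy_law0] and [greedy_lawS]. *)
Fixpoint greedy_law_rec (m : nat) (S Q I : {set V}) : R :=
  if m is m'.+1 then
    if Q == set0 then (I == S)%:R
    else \sum_(v in Q)
           #|Q|%:R^-1 * greedy_law_rec m' (v |: S) (greedy_next S Q v) I
  else (I == S)%:R.

Definition greedy_law (S Q I : {set V}) : R := greedy_law_rec #|Q| S Q I.

Lemma card_greedy_next (S Q : {set V}) v :
  v \in Q -> (#|greedy_next S Q v| < #|Q|)%N.
Proof.
move=> vQ; rewrite (cardsD1 v Q) vQ ltnS; apply: subset_leq_card.
by apply/subsetP => w; rewrite inE => /andP[].
Qed.

Lemma greedy_law_recE m (S Q I : {set V}) :
  (#|Q| <= m)%N -> greedy_law_rec m S Q I = greedy_law S Q I.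
Proof.
rewrite /greedy_law; have [k] := ubnP #|Q|.
elim: k m S Q => // k IHk m S Q; rewrite ltnS => Qk Qm.
have [->|Q0] := eqVneq Q set0.
  by rewrite cards0; case: m {Qm} => //= m; rewrite eqxx.
move: (Q0); rewrite -card_gt0; case: m Qm => [|m]; first by case: #|Q|.
case EQ: #|Q| Qk => [//|q] Qk Qm _ /=; rewrite (negPf Q0) EQ.
apply: eq_bigr => v vQ; congr (_ * _).
have := card_greedy_next S vQ; rewrite EQ ltnS => le.
have ltk : (#|greedy_next S Q v| < k)%N by exact: leq_ltn_trans le Qk.
by rewrite IHk // ?IHk // (leq_trans le).
Qed.

Lemma greedy_law0 (S I : {set V}) : greedy_law S set0 I = (I == S)%:R.
Proof. by rewrite /greedy_law cards0. Qed.

Lemma greedy_lawS (S Q I : {set V}) : Q != set0 ->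
  greedy_law S Q I =
  \sum_(v in Q) #|Q|%:R^-1 * greedy_law (v |: S) (greedy_next S Q v) I.
Proof.
move=> Q0; rewrite -(@greedy_law_recE #|Q|.+1) //= (negPf Q0).
apply: eq_bigr => v vQ; rewrite greedy_law_recE //.
exact/ltnW/card_greedy_next.
Qed.

Lemma greedy_law_sum1 (S Q : {set V}) : \sum_(I : {set V}) greedy_law S Q I = 1.
Proof.
have [k] := ubnP #|Q|; elim: k S Q => // k IHk S Q; rewrite ltnS => Qk.
have [->|Q0] := eqVneq Q set0.
  rewrite (bigD1 S) //= greedy_law0 eqxx big1 ?addr0 // => I /negPf IS.
  by rewrite greedy_law0 IS.
under eq_bigr do rewrite greedy_lawS //.
rewrite exchange_big /=.
rewrite (eq_bigr (fun=> #|Q|%:R^-1)).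
  by rewrite sumr_const -[LHS]mulr_natr mulVf // pnatr_eq0 cards_eq0.
move=> v vQ; rewrite -mulr_sumr IHk ?mulr1 //.
exact: leq_trans (card_greedy_next S vQ) Qk.
Qed.

Definition greedy_output (I : {set V}) : R := greedy_law set0 [set: V] I.

Definition greedy_expected_size : R :=
  \sum_(I : {set V}) greedy_output I * #|I|%:R.

End Greedy.

From mathcomp Require Import all_classical all_reals all_analysis.
Import numFieldNormedType.Exports.
Local Open Scope classical_set_scope.
Local Open Scope ring_scope.

Section Constants.
Variable R : realType.

Definition u_series (d r : nat) (x : R) : R^nat :=
  series (fun n => 'C(n + d - 2, d - 2)%:R * (x ^+ (r * n + 1) / (r * n + 1)%:R)).

Definition is_u (d r : nat) (x : R) : Prop :=
  0 < x /\ u_series d r x @ \oo --> (1 : R).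

Definition u (d r : nat) : R := get (is_u d r).

Definition f (d r : nat) : R := u d r - u d r ^+ r.+1 / r.+1%:R.

Definition epsilon (g d r : nat) : R :=
  (d * (d - 1) ^ ((g - 3) %/ 2))%:R /
  (r%:R * \prod_(1 <= k < ((g - 1) %/ 2).+1) (k%:R + r%:R^-1)).

End Constants.

(* Main.v *)
Require Import Defs.
From mathcomp Require Import all_boot all_order all_algebra.
From mathcomp Require Import ring lra zify.

Set Implicit Arguments.
Unset Strict Implicit.
Unset Printing Implicit Defensive.

Import Order.TTheory GRing.Theory Num.Theory.

Local Open Scope ring_scope.

(* Give the vertices independent uniform labels in [{0, .., N-1}]. When the labels
   are distinct, the random greedy algorithm processes the vertices by increasing
   label, and the indicator of its output is a fixed point of the map [label_step],
   which says that a vertex is rejected iff some edge through it has all its other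
   vertices selected earlier. This map reverses order on [[0, 1]], so the indicator
   lies between the [K]-th iterates started at 0 and at 1, and these iterates only
   look at the ball of radius [K]. For [K = (g - 1) / 2] that ball is a hypertree, so
   independence turns the expectations of the two iterates into a one-dimensional
   recursion ([tree_step]). The Euler scheme of [a' = (1 - a^r)^(d-1)] is a fixed
   point of the same recursion and lies between the same two iterates, whose distance
   is at most [epsilon]. As [N] tends to infinity, ties disappear and the Euler scheme
   converges: [a(1) = u], because [u_sum] is the inverse function of [a], and the
   value at the root is the integral of [1 - t^r] from 0 to [u], which is [f]. *)

(** * Greedy selection along a uniformly random vertex order *)

Section GreedyOrder.
Variables (R : realFieldType) (G : hypergraph).
Local Notation V := (vertex G).
Implicit Types (S Q A I : {set V}) (t : seq V).

Lemma independentS S S' : S \subset S' -> independent S' -> independent S.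
Proof.
move=> sS; apply: contra => /existsP[e /andP[eE eS]].
by apply/existsP; exists e; rewrite eE (subset_trans eS sS).
Qed.

Definition greedy_value S Q : R := \sum_(I : {set V}) greedy_law R S Q I * #|I|%:R.

Lemma greedy_value0 S : greedy_value S set0 = #|S|%:R.
Proof.
rewrite /greedy_value (bigD1 S) //= greedy_law0 eqxx mul1r big1 ?addr0 // => I /negPf IS.
by rewrite greedy_law0 IS mul0r.
Qed.

(** Keeping the factor [#|Q|] on the left makes the one-step recursion valid for empty [Q] as
    well. *)
Lemma greedy_valueS S Q :
  #|Q|%:R * greedy_value S Q = \sum_(v in Q) greedy_value (v |: S) (greedy_next S Q v).
Proof.
have [->|Q0] := eqVneq Q set0; first by rewrite cards0 mul0r big_set0.
rewrite /greedy_value exchange_big mulr_sumr; apply: eq_bigr => I _.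
rewrite greedy_lawS // -mulr_sumr -mulr_suml !mulrA mulfV ?mul1r //.
by rewrite pnatr_eq0 cards_eq0.
Qed.

Lemma greedy_value_le_alpha S Q : independent S ->
  (forall w, w \in Q -> independent (w |: S)) -> greedy_value S Q <= (alpha G)%:R.
Proof.
have [k] := ubnP #|Q|; elim: k S Q => // k IHk S Q; rewrite ltnS => Qk iS iQ.
have [->|Q0] := eqVneq Q set0.
  by rewrite greedy_value0 ler_nat /alpha; exact: (@leq_bigmax_cond _ _ (fun S : {set V} => #|S|) S).
have cQ : 0 < #|Q|%:R :> R by rewrite ltr0n card_gt0.
rewrite -(ler_pM2l cQ) greedy_valueS mulr_natl -sumr_const.
apply: ler_sum => v vQ; apply: IHk.
- exact: leq_trans (card_greedy_next S vQ) Qk.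
- exact: iQ.
- by move=> w; rewrite inE => /andP[].
Qed.

(** The algorithm read along a fixed order: closed vertices are visited and skipped instead of being
    discarded in advance, so any order of all the vertices is a valid input. *)
Fixpoint greedy_run S t : {set V} :=
  if t is x :: t' then greedy_run (if independent (x |: S) then x |: S else S) t' else S.

Lemma big_tuple_cons k (P : pred (seq V)) (F : seq V -> R) :
  \sum_(t : k.+1.-tuple V | P t) F t =
  \sum_(x : V) \sum_(t : k.-tuple V | P (x :: t)) F (x :: t).
Proof.
rewrite pair_big_dep /=.
rewrite (reindex (fun p : V * k.-tuple V => cons_tuple p.1 p.2)) //=.
exists (fun t : k.+1.-tuple V => (thead t, behead_tuple t)).
  by move=> [x t] _ /=; congr pair; apply: val_inj.
by move=> t _ /=; apply: val_inj; rewrite [in RHS](tuple_eta t).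
Qed.

(* [A] is the set of unprocessed vertices. A closed vertex drawn first leaves the
   value unchanged, so averaging over it does not change the expectation. *)
Lemma greedy_run_sum k A S : #|A| = k ->
  \sum_(t : k.-tuple V | uniq t && all (mem A) t) #|greedy_run S t|%:R =
  k`!%:R * greedy_value S [set v in A | independent (v |: S)].
Proof.
elim: k A S => [|k IHk] A S cA.
  have -> : A = set0 by apply/eqP; rewrite -cards_eq0 cA.
  rewrite (eq_bigl (fun t : 0.-tuple V => t == [tuple])); last by move=> t; rewrite tuple0.
  rewrite big_pred1_eq /= mul1r -[LHS]greedy_value0; congr greedy_value.
  by apply/setP => v; rewrite !inE.
rewrite (big_tuple_cons _ (fun t => uniq t && all (mem A) t) (fun t => #|greedy_run S t|%:R)).
transitivity (\sum_(x in A) k`!%:R * greedy_value (if independent (x |: S) then x |: S else S)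
  [set v in A :\ x | independent (v |: (if independent (x |: S) then x |: S else S))]).
  rewrite [LHS](bigID (mem A)) /= [X in _ + X]big1 ?addr0; last first.
    by move=> x /negPf xA; apply: big_pred0 => t; rewrite xA /= andbF.
  apply: eq_bigr => x xA; rewrite -IHk; last by rewrite (cardsD1 x) xA in cA; case: cA.
  apply: eq_bigl => t; rewrite xA /=.
  have -> : all (mem (A :\ x)) t = (x \notin tval t) && all (mem A) t.
    elim: (tval t) => //= y s ->; rewrite !inE negb_or (eq_sym y).
    by case: (x == y); case: (y \in A); rewrite //= andbF.
  by rewrite -andbA andbCA.
set Q := [set v in A | independent (v |: S)].
have QA : Q \subset A by apply/subsetP => v; rewrite inE => /andP[].
rewrite -mulr_sumr factS natrM -mulrA mulrCA; congr (_ * _).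
rewrite (bigID (mem Q)) /=.
have -> : k.+1%:R * greedy_value S Q = #|Q|%:R * greedy_value S Q + #|A :\: Q|%:R * greedy_value S Q.
  by rewrite -mulrDl -natrD -cA -(cardsID Q A) (setIidPr QA).
congr (_ + _).
  rewrite greedy_valueS (eq_bigl (fun x => x \in Q)); last first.
    by move=> x; rewrite /= !inE; case: (x \in A).
  apply: eq_bigr => x; rewrite inE => /andP[xA ix]; rewrite ix; congr greedy_value.
  have -> : greedy_next S Q x = [set w in Q :\ x | independent (w |: (x |: S))] by [].
  apply/setP => v; rewrite !inE.
  case vx: (v == x) => //=; case: (v \in A) => //=.
  have [iv|] := boolP (independent (v |: (x |: S))); last by rewrite andbF.
  rewrite (independentS _ iv) //; last by rewrite setUS // subsetUr.
rewrite mulr_natl -sumr_const; apply: eq_big => [x|x /andP[xA xQ]].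
  by rewrite !inE andbC.
have ix : ~~ independent (x |: S) by move: xQ; rewrite inE xA.
rewrite (negPf ix); congr greedy_value; apply/setP => v; rewrite !inE.
by have [->|] := eqVneq v x; rewrite //= (negPf ix) andbF.
Qed.

Lemma greedy_run_sub S t : S \subset greedy_run S t.
Proof.
elim: t S => //= x t IH S; apply: subset_trans (IH _).
by case: ifP => // _; apply: subsetUr.
Qed.

Lemma greedy_run_mem S t v : v \in greedy_run S t -> (v \in S) || (v \in t).
Proof.
elim: t S => [|x t IH] S /=; first by rewrite orbF.
move=> /IH; rewrite inE; case: ifP => _; rewrite ?inE.
  by case: (v == x); case: (v \in S).
by case: (v \in S) => //= ->; rewrite orbT.
Qed.

Lemma greedy_run_indep S t : independent S -> independent (greedy_run S t).
Proof. by elim: t S => //= x t IH S iS; apply: IH; case: ifP. Qed.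

Lemma greedy_run_cat S t t' : greedy_run S (t ++ t') = greedy_run (greedy_run S t) t'.
Proof. by elim: t S => /=. Qed.


(** The list visits [v] once, so its fate is decided by the set selected at that moment. *)
Lemma greedy_run_memE t1 v t2 S : v \notin S -> uniq (t1 ++ v :: t2) ->
  (v \in greedy_run S (t1 ++ v :: t2)) = independent (v |: greedy_run S t1).
Proof.
move=> vS; rewrite cat_uniq /= negb_or => /and3P[_ /andP[vt1 _] /andP[vt2 _]].
rewrite greedy_run_cat /=; case: ifP => [_|ni].
  by apply: (subsetP (greedy_run_sub _ _)); rewrite setU11.
apply/negbTE/negP => /greedy_run_mem; rewrite (negPf vt2) orbF => /greedy_run_mem.
by rewrite (negPf vS) (negPf vt1).
Qed.

(** For 0/1-valued [X], the factor of [e] vanishes exactly when [e] blocks [v]. The product form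
    allows averaging factor by factor. *)
Definition label_step (l : V -> nat) (X : V -> R) (v : V) : R :=
  \prod_(e in edges G | v \in e)
    (1 - \prod_(w in e :\ v) ((l w < l v)%N%:R * X w)).

Lemma greedy_run_fixed (l : V -> nat) t : (forall v, v \in t) ->
  sorted ltn [seq l v | v <- t] ->
  let X v : R := (v \in greedy_run set0 t)%:R in label_step l X =1 X.
Proof.
move=> tV st X v; rewrite /label_step /X.
have : v \in t by []; case/splitPr def_t: t / => [t1 t2].
have ut : uniq t by move: st; rewrite ltn_sorted_uniq_leq => /andP[/map_uniq].
have lt1 w : w \in t1 -> (l w < l v)%N.
  move=> wt1; move: st; rewrite def_t map_cat /= sorted_pairwise; last exact: ltn_trans.
  rewrite pairwise_cat => /and3P[/allrelP H _ _]; apply: H; first exact: map_f.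
  by rewrite inE eqxx.
have lt2 w : w \in t2 -> (l v < l w)%N.
  move=> wt2; move: st; rewrite def_t map_cat /= sorted_pairwise; last exact: ltn_trans.
  rewrite pairwise_cat /= => /and3P[_ _ /andP[/allP H _]]; apply: H.
  exact: map_f.
(* The selected vertices of smaller label than [v] are those selected before [v] is visited, so
   [label_step] and the run test the same condition. *)
have runE w : (l w < l v)%N && (w \in greedy_run set0 t) = (w \in greedy_run set0 t1).
  apply/idP/idP => [/andP[lw]|w1].
    rewrite def_t greedy_run_cat => /greedy_run_mem /orP[//|].
    by rewrite inE => /predU1P[wv|/lt2]; [move: lw; rewrite wv ltnn | rewrite ltnNge ltnW].
  rewrite def_t greedy_run_cat (subsetP (greedy_run_sub _ _) _ w1) andbT.
  by apply: lt1; move/greedy_run_mem: w1; rewrite inE.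
have prodE (e : {set V}) :
    \prod_(w in e :\ v) ((l w < l v)%N%:R * (w \in greedy_run set0 t)%:R : R) =
    (e :\ v \subset greedy_run set0 t1)%:R.
  have [/subsetP sub|/subsetPn[w we wn]] := boolP (e :\ v \subset _).
    by rewrite big1 // => w /sub w1; rewrite -natrM mulnb runE w1.
  by rewrite (bigD1 w) //= -natrM mulnb runE (negPf wn) mul0r.
under eq_bigr do rewrite -def_t prodE.
rewrite greedy_run_memE ?inE // -?def_t //.
have ind1 : independent (greedy_run set0 t1).
  apply: greedy_run_indep; apply/existsP => -[e /andP[eE]].
  by rewrite subset0 => /eqP e0; move: (edges_nonempty G); rewrite -e0 eE.
have subE (e : {set V}) : (e \subset v |: greedy_run set0 t1) = (e :\ v \subset greedy_run set0 t1).
  by rewrite subDset.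
have [iv|/negPn/existsP[e /andP[eE esub]]] := boolP (independent _).
  rewrite big1 // => e /andP[eE ve].
  have /negPf-> : ~~ (e :\ v \subset greedy_run set0 t1); last by rewrite subr0.
  rewrite -subE; apply: contra iv => esub; apply/existsP; exists e.
  by rewrite eE.
(* The earlier selection is independent, so an edge completed by adding [v] must contain [v]. *)
have ve : v \in e.
  apply/negPn/negP => vNe; move/negP: ind1; apply; apply/existsP; exists e.
  have eD : e :\ v = e.
    by apply/setP => w; rewrite !inE; case: eqP => // ->; rewrite (negPf vNe).
  by rewrite eE -{1}eD -subE.
by rewrite (bigD1 e) ?eE //= -subE esub subrr mul0r.
Qed.

Section Labels.
Variable N : nat.
Implicit Types l : {ffun V -> 'I_N}.

Definition increasing l (t : seq V) := sorted ltn [seq (l v : nat) | v <- t].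

Lemma uniq_tuple_all (t : #|V|.-tuple V) v : uniq t -> v \in t.
Proof.
move=> ut; have /subset_leqif_card/leqifP : [set x in t] \subset [set: V] by apply: subsetT.
have -> : #|[set x in t]| = #|V| by rewrite cardsE (card_uniqP ut) size_tuple.
rewrite cardsT ltnn; case: ifP => // /subsetP sub _.
by have := sub v; rewrite !inE; apply.
Qed.

Lemma increasing_uniq l t : increasing l t -> uniq t.
Proof. by rewrite /increasing ltn_sorted_uniq_leq => /andP[/map_uniq]. Qed.

(** A labelling without ties increases along exactly one order, the sorted one; a labelling with a
    tie increases along none. *)
Lemma sum_increasing (H : {ffun V -> 'I_N} -> R) :
  \sum_(t : #|V|.-tuple V | uniq t) \sum_(l | increasing l t) H l =
  \sum_(l : {ffun V -> 'I_N} | injectiveb l) H l.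
Proof.
rewrite (exchange_big_dep predT) //= [RHS]big_mkcond; apply: eq_bigr => l _.
case: injectiveP => [il|nil]; last first.
  apply: big_pred0 => t; apply/negbTE/negP => /andP[ut]; rewrite /increasing.
  rewrite ltn_sorted_uniq_leq => /andP[um _]; apply: nil => v w lvw.
  have [iv iw] := (uniq_tuple_all v ut, uniq_tuple_all w ut).
  have /(nth_uniq 0%N) := um => /(_ (index v t) (index w t)).
  rewrite size_map !index_mem iv iw => /(_ isT isT).
  rewrite !(nth_map v) ?index_mem // !nth_index // lvw eqxx => /esym/eqP.
  by move/(congr1 (nth v t)); rewrite !nth_index.
pose s := sort (relpre (fun v => l v : nat) leq) (enum V).
have ss : size s == #|V| by rewrite size_sort -cardE.
have is_ : increasing l s.
  rewrite /increasing ltn_sorted_uniq_leq map_inj_uniq; last by move=> v w /val_inj/il.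
  rewrite sort_uniq enum_uniq sorted_map; apply: sort_sorted.
  by move=> v w; apply: leq_total.
rewrite (eq_bigl (pred1 (Tuple ss))) ?big_pred1_eq // => t /=.
apply/andP/eqP => [[ut it]|->]; last by split; rewrite //= ?(increasing_uniq is_).
apply: val_inj => /=; apply: (@inj_map _ _ (fun v => l v : nat)); first by move=> v w /val_inj/il.
apply: (irr_sorted_eq ltn_trans ltnn it is_) => x.
have eqm : t =i s by move=> v; rewrite mem_sort mem_enum uniq_tuple_all.
by apply/mapP/mapP => -[v vt ->]; exists v; rewrite // ?eqm // -eqm.
Qed.

(** Transport along the bijection [tnth t] removes the dependence on [t]; hence labels without ties
    induce a uniform order. *)
Lemma card_increasing (t : #|V|.-tuple V) : uniq t ->
  #|[pred l | increasing l t]| =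
  #|[pred m : {ffun 'I_#|V| -> 'I_N} | sorted ltn [seq (m i : nat) | i <- enum 'I_#|V|]]|.
Proof.
move=> ut; have it : injective (tnth t) by apply/tuple_uniqP.
have [t' tK Kt] : bijective (tnth t) by apply: inj_card_bij; rewrite ?card_ord.
rewrite -[LHS]sum1_card -[RHS]sum1_card [RHS](reindex (fun l => [ffun i => l (tnth t i)])) /=.
  apply: eq_bigl => l; rewrite !inE /increasing -[in LHS](map_tnth_enum t) -map_comp.
  by congr (sorted _ _); apply: eq_map => i /=; rewrite ffunE.
exists (fun m => [ffun v => m (t' v)]) => m _; apply/ffunP => i; rewrite !ffunE.
  by rewrite Kt.
by rewrite tK.
Qed.

(** [greedy_run_sum] computes the sum over orders and [card_increasing] supplies their common
    multiplicity. Independence of singletons makes every vertex open at the start. *)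
Lemma greedy_value_labels : (forall v : V, independent [set v]) ->
  #|[pred l : {ffun V -> 'I_N} | injectiveb l]|%:R * greedy_expected_size R G =
  \sum_(t : #|V|.-tuple V | uniq t) \sum_(l | increasing l t) #|greedy_run set0 t|%:R.
Proof.
move=> ind1; set c := #|[pred m : {ffun 'I_#|V| -> 'I_N} | sorted ltn [seq (m i : nat) | i <- enum 'I_#|V|]]|.
have sumc (F : seq V -> R) : \sum_(t : #|V|.-tuple V | uniq t) \sum_(l | increasing l t) F t =
    c%:R * \sum_(t : #|V|.-tuple V | uniq t) F t.
  rewrite mulr_sumr; apply: eq_bigr => t ut.
  by rewrite sumr_const card_increasing // mulr_natl.
have -> : #|[pred l : {ffun V -> 'I_N} | injectiveb l]|%:R = c%:R * (#|V|`!)%:R :> R.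
  have E := sum_increasing (fun=> 1); rewrite (sumc (fun=> 1)) [RHS]sumr_const in E.
  rewrite -{}E.
  congr (_ * _); rewrite sumr_const; congr _%:R.
  have := card_uniq_tuples #|V| (mem V); rewrite ffactnn => <-; rewrite cardsE.
  apply: eq_card => t; rewrite !unfold_in /=.
  by case: (uniq t); rewrite ?andbF // andbT; apply/esym/allP.
rewrite (sumc (fun t => #|greedy_run set0 t|%:R)) -mulrA; congr (_ * _).
rewrite -[greedy_expected_size R G]/(greedy_value set0 setT).
have := greedy_run_sum set0 (cardsT V).
have -> : [set v in [set: V] | independent (v |: set0)] = setT.
  by apply/setP => v; rewrite !inE setU0 ind1.
move=> <-; apply: eq_bigl => t; case: (uniq t) => //=.
by apply/allP => v; rewrite inE.
Qed.

End Labels.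
End GreedyOrder.

(** * Closed walks in the incidence graph and disjointness of branches *)

Section Walks.
Variable G : hypergraph.
Local Notation V := (vertex G).
Local Notation T := (V + {set V})%type.
Local Open Scope nat_scope.

(** Adjacency in the bipartite incidence graph, where a Berge [k]-cycle is a cycle of length
    [2k]. *)
Definition incident (x y : T) : bool :=
  match x, y with
  | inl v, inr e | inr e, inl v => (e \in edges G) && (v \in e)
  | _, _ => false
  end.

Lemma incident_sym x y : incident x y = incident y x.
Proof. by case: x y => [v|e] [w|e']. Qed.

Definition is_vertex (x : T) := if x is inl _ then true else false.

Lemma is_vertex_alt (x : nat -> T) m : (forall j, j < m -> incident (x j) (x j.+1)) ->
  forall j, j <= m -> is_vertex (x j) = is_vertex (x 0) (+) odd j.
Proof.
move=> adj; elim=> [|j IHj] jm; first by rewrite addbF.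
move: (adj j jm) (IHj (ltnW jm)); rewrite /= addbN => + <-.
by case: (x j) (x j.+1) => [v|e] [w|e'].
Qed.

(* A closed walk between two occurrences of the same point, taken as short as
   possible, is simple; without backtracking its length is at least 3. *)
Lemma closed_walk_berge_cycle (x : nat -> T) m : 0 < m ->
  (forall j, j < m -> incident (x j) (x j.+1)) ->
  (forall j, j.+1 < m -> x j != x j.+2) ->
  x 0 = x m -> exists2 k, k.*2 <= m & has_berge_cycle G k.
Proof.
have [n] := ubnP m; elim: n x m => // n IHn x m; rewrite ltnS => mn m0 adj nb x0m.
have [/existsP[a /existsP[b /and3P[ab bam /eqP xab]]]|nex] :=
    boolP [exists a : 'I_m.+1, exists b : 'I_m.+1, [&& a < b, b - a < m & x a == x b]].
  have bm : b <= m by rewrite -ltnS.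
  have [||j jm|j jm||k km hk] := IHn (fun j => x (a + j)) (b - a).
  - lia.
  - by rewrite subn_gt0.
  - by rewrite addnS; apply: adj; lia.
  - by rewrite !addnS; apply: nb; lia.
  - by rewrite addn0 subnKC // ltnW.
  - by exists k => //; lia.
have dist a b : a <= m -> b <= m -> a - b < m -> b - a < m -> x a = x b -> a = b.
  move=> am bm abm bam xab.
  wlog ab : a b am bm abm bam xab / a < b.
    move=> H; have [/H|/H|//] := ltngtP a b; first exact.
    by move=> H'; rewrite H' // xab.
  case/negP: nex; apply/existsP; exists (Ordinal (am : a < m.+1)).
  apply/existsP; exists (Ordinal (bm : b < m.+1)).
  by rewrite /= ab bam xab eqxx.
have alt := is_vertex_alt adj.
have em : ~~ odd m by have := alt m (leqnn m); rewrite -x0m; case: (is_vertex _); case: odd.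
have m2 : 2 < m.
  case: m m0 {mn adj dist alt IHn nex} nb em x0m => [|[|[|m]]] // _ nb _ x02.
  by have := nb 0 isT; rewrite x02 eqxx.
pose k := m./2; have mE : m = k.*2 by rewrite /k halfK (negPf em) subn0.
(* [v0] is only the default value of [vx] at edge positions. *)
have [v0 _] : exists v0 : V, true.
  move: (alt 1 (ltnW (ltnW m2))); case: (x 0) => [v _|e]; first by exists v.
  by case: (x 1) => // v _; exists v.
pose vx j := if x j is inl v then v else v0.
pose ex j := if x j is inr e then e else set0.
have vxE j : is_vertex (x j) -> x j = inl (vx j) by rewrite /vx; case: (x j).
have exE j : ~~ is_vertex (x j) -> x j = inr (ex j) by rewrite /ex; case: (x j).
have predE (i : 'I_k) : ord_pred i = (if i == 0 :> nat then k.-1 else i.-1) :> nat.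
  rewrite /=; case: i => [[|i] ik] /=; first by rewrite add0n modn_small //; lia.
  by rewrite addnC modnDl modn_small //; lia.
exists k; first by rewrite mE.
have [v0x|e0x] := boolP (is_vertex (x 0)).
(* Starting at a vertex: [e_i] sits at [2i + 1], between its vertices at [2i] and [2i + 2]; for
   [i = 0] the former is the last vertex, because the walk is closed. *)
- have even_v j : j.*2 <= m -> x j.*2 = inl (vx j.*2).
    by move=> jm; apply: vxE; rewrite alt // v0x odd_double.
  have odd_e j : j.*2 < m -> x j.*2.+1 = inr (ex j.*2.+1).
    by move=> jm; apply: exE; rewrite alt // v0x /= odd_double.
  exists (fun i : 'I_k => ex i.*2.+1), (fun i : 'I_k => vx i.*2.+2); split; first lia.
  + move=> i j /= eij; have im := ltn_ord i; have jm := ltn_ord j; apply: val_inj => /=.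
    have : i.*2.+1 = j.*2.+1; last lia.
    by apply: dist; [lia..|rewrite !odd_e ?eij //; lia].
  + move=> i j /= eij; have im := ltn_ord i; have jm := ltn_ord j; apply: val_inj => /=.
    have : i.+1.*2 = j.+1.*2; last lia.
    by apply: dist; [lia..|rewrite !even_v ?doubleS ?eij //; lia].
  + move=> i; have im := ltn_ord i.
    have := adj i.*2.+1; rewrite -doubleS even_v ?odd_e; [|lia..].
    move=> /(_ _)/andP[|-> ->]; first by lia.
    split=> //; rewrite predE; case: eqP => [i0|i0].
      rewrite i0 -doubleS prednK; last lia.
      have xm : x m = inl (vx k.*2) by rewrite {1}mE even_v // mE.
      by have := adj 0 m0; rewrite x0m xm (odd_e 0) // => /andP[].
    have -> : i.-1.*2.+2 = i.*2 by lia.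
    have := adj i.*2; rewrite even_v ?odd_e; [|lia..].
    by move=> /(_ _)/andP[|//]; lia.
(* Starting at an edge: [e_i] sits at [2i], between its vertices at [2i - 1] and [2i + 1]; for
   [i = 0] the former is the vertex at position [m - 1]. *)
- have even_e j : j.*2 <= m -> x j.*2 = inr (ex j.*2).
    by move=> jm; apply: exE; rewrite alt // (negPf e0x) odd_double.
  have odd_v j : j.*2 < m -> x j.*2.+1 = inl (vx j.*2.+1).
    by move=> jm; apply: vxE; rewrite alt // (negPf e0x) /= odd_double.
  exists (fun i : 'I_k => ex i.*2), (fun i : 'I_k => vx i.*2.+1); split; first lia.
  + move=> i j /= eij; have im := ltn_ord i; have jm := ltn_ord j; apply: val_inj => /=.
    have : i.*2 = j.*2; last lia.
    by apply: dist; [lia..|rewrite !even_e ?eij //; lia].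
  + move=> i j /= eij; have im := ltn_ord i; have jm := ltn_ord j; apply: val_inj => /=.
    have : i.*2.+1 = j.*2.+1; last lia.
    by apply: dist; [lia..|rewrite !odd_v ?eij //; lia].
  + move=> i; have im := ltn_ord i.
    have := adj i.*2; rewrite even_e ?odd_v; [|lia..].
    move=> /(_ _)/andP[|-> ->]; first by lia.
    split=> //; rewrite predE; case: eqP => [i0|i0].
      rewrite i0; have := adj k.-1.*2.+1; rewrite -doubleS prednK; last lia.
      rewrite -mE -x0m odd_v; last lia.
      by rewrite (even_e 0) // => /(_ _)/andP[|//]; lia.
    have := adj i.-1.*2.+1; rewrite -doubleS prednK; last lia.
    rewrite odd_v ?even_e; [|lia..].
    by move=> /(_ _)/andP[|//]; lia.
Qed.

(* Non-backtracking walks in the bipartite incidence graph. *)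
Fixpoint nbwalk (s : seq T) : bool :=
  if s is a :: t then
    (if t is b :: t' then incident a b && (if t' is c :: _ then a != c else true) else true)
    && nbwalk t
  else true.

(** The condition involves at most three consecutive entries, so walks overlapping in two entries
    can be glued. *)
Lemma nbwalk_glue s a b t : nbwalk (s ++ [:: a; b]) -> nbwalk [:: a, b & t] ->
  nbwalk (s ++ [:: a, b & t]).
Proof.
elim: s => [//|c s IHs] /= /andP[H1 H2] H3; rewrite IHs // andbT.
by case: s H1 {IHs H2} => [|c' [|c'' s]].
Qed.

Lemma nbwalk_rev s : nbwalk s -> nbwalk (rev s).
Proof.
elim: s => [//|a [|b [|c t]] IHs] //.
  by rewrite /= incident_sym /rev /= => ->.
move=> /= /andP[/andP[ab ac] H]; move: (H) => /andP[/andP[bc _] _].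
rewrite !rev_cons -!cats1 -!catA /=; apply: nbwalk_glue.
  by have := IHs H; rewrite !rev_cons -!cats1 -!catA /=.
by rewrite /= incident_sym bc incident_sym ab eq_sym ac.
Qed.

Lemma nbwalk_nth x0 s i : nbwalk s -> i.+1 < size s -> incident (nth x0 s i) (nth x0 s i.+1).
Proof.
elim: s i => [//|a s IHs] [|i] /andP[H1 H2] H; last exact: IHs.
by case: s H1 H {IHs H2} => [//|b s] /andP[].
Qed.

Lemma nbwalk_nth2 x0 s i : nbwalk s -> i.+2 < size s -> nth x0 s i != nth x0 s i.+2.
Proof.
elim: s i => [//|a s IHs] [|i] /andP[H1 H2] H; last exact: IHs.
by case: s H1 H {IHs H2} => [//|b [//|c s]] /andP[].
Qed.

(** A repeated entry cuts out a closed walk, which has fewer steps than [s] has entries. *)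
Lemma nbwalk_berge_cycle s : nbwalk s -> ~~ uniq s ->
  exists2 k, k.*2 < size s & has_berge_cycle G k.
Proof.
case: s => // x0 s; move: (x0 :: s) => {}s ws /(uniqPn x0)[i [j [ij js xij]]].
have [|l lm|l lm||k km hk] := @closed_walk_berge_cycle (fun l => nth x0 s (i + l)) (j - i).
- by rewrite subn_gt0.
- by rewrite addnS; apply: nbwalk_nth => //; apply: leq_ltn_trans js; lia.
- by rewrite !addnS; apply: nbwalk_nth2 => //; apply: leq_ltn_trans js; lia.
- by rewrite addn0 subnKC // ltnW.
- by exists k => //; apply: leq_ltn_trans js; lia.
Qed.

(* The endpoints of the non-backtracking walks with at most [k] edges that leave
   [v] by an edge other than [e]. *)
Fixpoint nbball (k : nat) (e : {set V}) (v : V) : {set V} :=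
  v |: (if k is k'.+1 then
     \bigcup_(e' in edges G | (v \in e') && (e' != e)) \bigcup_(w in e' :\ v) nbball k' e' w
   else set0).

(** Listing [e] in front records how [v] was entered, so the ban on backtracking carries over when
    walks are extended. *)
Lemma nbball_walk k e v x : e \in edges G -> v \in e -> x \in nbball k e v ->
  exists p, [/\ nbwalk [:: inr e, inl v & p], last (inl v) p = inl x & size p <= k.*2].
Proof.
elim: k e v => [|k IHk] e v eE ve /=; rewrite in_setU1.
  rewrite inE orbF => /eqP ->; exists [::]; split=> //=.
  by rewrite eE ve.
case/predU1P=> [->|]; first by exists [::]; rewrite /= eE ve.
move=> /bigcupP[e' /and3P[e'E ve' e'e] /bigcupP[w]].
rewrite !inE => /andP[wv we'] /(IHk _ _ e'E we')[p [wp lp sp]].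
exists [:: inr e', inl w & p]; split=> //.
move: wp => /= ->; rewrite eE ve e'E ve' !andbT /=; apply/andP; split.
  by apply: contra e'e => /eqP[->].
by apply: contra wv => /eqP[->].
Qed.

Lemma nbball_self k e v : v \in nbball k e v.
Proof. by case: k => [|k]; rewrite /= setU11. Qed.

Section Tree.
Variable k : nat.
Hypothesis large_girth : forall j, has_berge_cycle G j -> k.+1.*2 < j.

(** Otherwise a walk leaving [v] through [e] and [w] returns to [v] with at most [2k + 3] entries,
    forcing a cycle of length at most [k + 1]. *)
Lemma nbball_notin e v w : e \in edges G -> v \in e -> w \in e -> w != v ->
  v \notin nbball k e w.
Proof.
move=> eE ve we wv; apply/negP => /(nbball_walk eE we)[p [wp lp sp]].
have [||j js /large_girth] := @nbwalk_berge_cycle [:: inl v, inr e, inl w & p].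
- move: wp => /= ->; rewrite eE ve /= andbT.
  by apply: contra wv => /eqP[->].
- by rewrite cons_uniq -lp !inE; have := mem_last (inl w : T) p; rewrite inE => ->; rewrite orbT.
- have {}js : j.*2 < k.*2.+3 by apply: leq_trans js _; rewrite !ltnS.
  by clear -js; lia.
Qed.

(** A common point would join the two walks, one reversed, through [e] when [e = e'] and through
    [e], [v], [e'] otherwise. At most [4k + 5] entries arise, hence a cycle of length at most
    [2k + 2]: this dictates the bound in [large_girth]. *)
Lemma nbball_disjoint e e' v w w' : e \in edges G -> e' \in edges G ->
  v \in e -> v \in e' -> w \in e -> w' \in e' -> w != v -> w' != v ->
  (e, w) != (e', w') -> [disjoint nbball k e w & nbball k e' w'].
Proof.
move=> eE e'E ve ve' we we' wv w'v ne; apply/pred0P => x /=; apply/negbTE/negP => /andP[].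
move=> /(nbball_walk eE we)[p [wp lp sp]] /(nbball_walk e'E we')[p' [wp' lp' sp']].
have {}wp : nbwalk (rev p ++ [:: inl w; inr e]).
  by have := nbwalk_rev wp; rewrite !rev_cons -!cats1 -catA.
have xin q : inl x \in q ++ [:: inl w' & p'].
  by rewrite mem_cat -lp' mem_last orbT.
have revE q : rev p ++ [:: inl w & q] = inl x :: rev (belast (inl w) p) ++ q.
  by rewrite -cat_rcons -rev_cons lastI rev_rcons lp.
have [ee|ee] := eqVneq e e'.
  rewrite -{}ee in wp' ne *; rewrite xpair_eqE eqxx /= in ne.
  have [||j js /large_girth] := @nbwalk_berge_cycle (rev p ++ [:: inl w, inr e, inl w' & p']).
  - apply: nbwalk_glue => //; move: wp' => /= ->; rewrite eE we /= andbT.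
    by apply: contra ne => /eqP[->].
  - by rewrite revE cons_uniq -(cat1s (inr e)) catA xin.
  - have {}js : j.*2 < k.*2 + k.*2.+3 by apply: leq_trans js _; rewrite size_cat size_rev leq_add.
    by clear -js; lia.
have [||j js /large_girth] :=
    @nbwalk_berge_cycle (rev p ++ [:: inl w, inr e, inl v, inr e', inl w' & p']).
- apply: nbwalk_glue => //; move: wp' => /= ->; rewrite eE we ve e'E ve' /= !andbT.
  apply/and3P; split; apply/eqP => -[].
  + by move/eqP; apply/negP.
  + by move/eqP; apply/negP.
  + by move/esym/eqP; apply/negP.
- by rewrite revE cons_uniq -(cat1s (inr e)) -(cat1s (inl v)) -(cat1s (inr e')) !catA xin.
- have {}js : j.*2 < k.*2 + k.*2.+4.+1.
    by apply: leq_trans js _; rewrite size_cat size_rev leq_add.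
  by clear -js; lia.
Qed.

End Tree.
End Walks.

(** * Averages over independent uniform labels *)

Section Average.
Variables (R : realFieldType) (V : finType) (N : nat).
Local Notation L := {ffun V -> 'I_N.+1}.
Implicit Types (F H : L -> R) (A B : {set V}).

Definition avg F : R := #|{: L}|%:R^-1 * \sum_l F l.

Lemma card_labels_gt0 : 0 < #|{: L}|%:R :> R.
Proof. by rewrite ltr0n card_ffun card_ord expn_gt0. Qed.

Lemma eq_avg F H : F =1 H -> avg F = avg H.
Proof. by move=> FH; congr (_ * _); apply: eq_bigr => l _. Qed.

Lemma avg_cst c : avg (fun=> c) = c.
Proof.
by rewrite /avg sumr_const -[X in _ * X]mulr_natl mulKf // gt_eqF // card_labels_gt0.
Qed.

Lemma avg_subr1 F : avg (fun l => 1 - F l) = 1 - avg F.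
Proof. by rewrite -{2}(avg_cst 1) /avg sumrB mulrBr. Qed.

Lemma avg_sum (I : finType) (F : I -> L -> R) :
  avg (fun l => \sum_i F i l) = \sum_i avg (F i).
Proof. by rewrite /avg exchange_big mulr_sumr. Qed.

Lemma avgZ c F : avg (fun l => c * F l) = c * avg F.
Proof. by rewrite /avg -mulr_sumr mulrCA. Qed.

Definition depends_on A F := forall l l' : L, {in A, l =1 l'} -> F l = F l'.

(* Swapping the labels of two independent copies off [A] is an involution. *)
Lemma avgM A B F H : depends_on A F -> depends_on B H -> [disjoint A & B] ->
  avg (fun l => F l * H l) = avg F * avg H.
Proof.
move=> dF dH dAB; pose mix (l l' : L) : L := [ffun v => if v \in A then l v else l' v].
have mixF l l' : F (mix l l') = F l by apply: dF => v vA; rewrite ffunE vA.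
have mixH l l' : H (mix l l') = H l'.
  apply: dH => v vB; rewrite ffunE; case: ifP => // vA.
  by have /pred0P/(_ v) := dAB; rewrite /= vA vB.
have mixK l l' : mix (mix l l') (mix l' l) = l.
  by apply/ffunP => v; rewrite !ffunE; case: (v \in A).
have E : (\sum_l F l) * (\sum_l H l) = #|{: L}|%:R * \sum_l F l * H l.
  rewrite big_distrlr /= pair_big /= mulr_natl -sumr_const pair_big /=.
  rewrite [LHS](reindex_inj (h := fun p => (mix p.2 p.1, mix p.1 p.2))) /=.
    by apply: eq_bigr => -[l l'] _ /=; rewrite mixF mixH.
  by move=> [l1 l2] [l3 l4] /= [E1 E2]; move: (mixK l1 l2) (mixK l2 l1); rewrite E1 E2 !mixK => -> ->.
rewrite /avg mulrACA E mulrA; congr (_ * _).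
by rewrite -mulrA mulVf ?mulr1 // gt_eqF // card_labels_gt0.
Qed.

Lemma avg_prod (I : eqType) (r : seq I) (A : I -> {set V}) (F : I -> L -> R) :
  uniq r -> {in r, forall i, depends_on (A i) (F i)} ->
  {in r &, forall i j, i != j -> [disjoint A i & A j]} ->
  avg (fun l => \prod_(i <- r) F i l) = \prod_(i <- r) avg (F i).
Proof.
elim: r => [|i r IHr] /= => [_ _ _|/andP[ir ur] dep dis].
  by under eq_avg do rewrite big_nil; rewrite avg_cst big_nil.
under eq_avg do rewrite big_cons.
rewrite big_cons (@avgM (A i) (\bigcup_(j <- r) A j)).
- congr (_ * _); apply: IHr => // [j jr|j k jr kr]; first by apply: dep; rewrite inE jr orbT.
  by apply: dis; rewrite inE ?jr ?kr orbT.
- by apply: dep; rewrite inE eqxx.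
- move=> l l' ll; apply: eq_big_seq => j jr; apply: dep => [|v vj].
    by rewrite inE jr orbT.
  apply: ll; rewrite big_tnth; apply/bigcupP.
  by move: vj; rewrite -(nth_index i jr) => vj; move: jr; rewrite -index_mem => jr;
     exists (Ordinal jr); rewrite // (tnth_nth i).
- rewrite disjoint_sym; elim: r ir {ur IHr dep} dis => [|j r IHr] ir dis.
    by rewrite big_nil disjoints_subset sub0set.
  rewrite big_cons disjoints_subset subUset -!disjoints_subset; apply/andP; split; last apply: IHr.
  + by apply: dis; rewrite ?inE ?eqxx ?orbT //; apply: contra ir => /eqP->; rewrite inE eqxx.
  + by move: ir; rewrite inE negb_or => /andP[].
  + move=> k k'; rewrite !inE => kr kr'; apply: dis; rewrite !inE.
      by case/orP: kr => ->; rewrite ?orbT.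
    by case/orP: kr' => ->; rewrite ?orbT.
Qed.

Lemma avg_prod_cond (I : finType) (P : pred I) (A : I -> {set V}) (F : I -> L -> R) :
  (forall i, P i -> depends_on (A i) (F i)) ->
  (forall i j, P i -> P j -> i != j -> [disjoint A i & A j]) ->
  avg (fun l => \prod_(i | P i) F i l) = \prod_(i | P i) avg (F i).
Proof.
move=> dep dis; rewrite -big_filter; under eq_avg do rewrite -big_filter.
apply: (@avg_prod _ _ A); first by rewrite filter_uniq // index_enum_uniq.
  by move=> i; rewrite mem_filter => /andP[/dep].
by move=> i j; rewrite !mem_filter => /andP[Pi _] /andP[Pj _]; apply: dis.
Qed.

Definition relabel (w : V) (j : 'I_N.+1) (l : L) : L := [ffun v => if v == w then j else l v].

(** Resampling the label of [w] preserves the uniform law, so an average can be computed by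
    conditioning on that label. *)
Lemma avg_relabel w F :
  avg F = N.+1%:R^-1 * \sum_(j < N.+1) avg (fun l => F (relabel w j l)).
Proof.
rewrite /avg -mulr_sumr mulrCA; congr (_ * _).
rewrite (exchange_big) pair_big /=.
(* The reindexing exchanges the label of [w] with the fresh one. *)
rewrite (reindex_inj (h := fun p : L * 'I_N.+1 => (relabel w p.2 p.1, p.1 w))) /=; last first.
  move=> [l j] [l' j'] /= [E1 E2].
  have Ej : j = j' by move/ffunP/(_ w): E1; rewrite !ffunE eqxx.
  congr pair; rewrite ?Ej //; apply/ffunP => v; move/ffunP/(_ v): E1; rewrite !ffunE.
  by case: eqP => // ->.
have -> : \sum_(p : L * 'I_N.+1) F (relabel w (p.1 w) (relabel w p.2 p.1)) =
    \sum_(l : L) \sum_(j < N.+1) F l.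
  rewrite pair_big_dep /=; apply: eq_bigr => -[l j] _ /=; congr F.
  by apply/ffunP => v; rewrite !ffunE; case: eqP => // ->.
rewrite [X in _ = _ * X](eq_bigr (fun l => N.+1%:R * F l)); last first.
  by move=> l _; rewrite sumr_const card_ord mulr_natl.
by rewrite -mulr_sumr mulKf // pnatr_eq0.
Qed.

End Average.

(** * Order-reversing maps and alternating bounds *)

Section Alternate.
Variables (R : realFieldType) (J : Type) (P : J -> Prop) (Psi : (J -> R) -> J -> R).
Hypothesis Psi_range : forall X : J -> R, (forall j, P j -> 0 <= X j <= 1) ->
  forall j, P j -> 0 <= Psi X j <= 1.
Hypothesis Psi_anti : forall X Y : J -> R, (forall j, P j -> 0 <= X j <= 1) ->
  (forall j, P j -> 0 <= Y j <= 1) -> (forall j, P j -> X j <= Y j) ->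
  forall j, P j -> Psi Y j <= Psi X j.

Lemma iter_range k (X : J -> R) : (forall j, P j -> 0 <= X j <= 1) ->
  forall j, P j -> 0 <= iter k Psi X j <= 1.
Proof. by move=> X01; elim: k => //= k IHk; apply: Psi_range. Qed.

(** Each application of an antitone map swaps the two bounds, so the parity of [k] decides which
    constant starts below. *)
Lemma iter_sandwich (X : J -> R) : (forall j, P j -> 0 <= X j <= 1) ->
  (forall j, P j -> Psi X j = X j) -> forall k j, P j ->
  iter k Psi (fun=> (odd k)%:R) j <= X j <= iter k Psi (fun=> (~~ odd k)%:R) j.
Proof.
move=> X01 fX.
have b01 (b : bool) (j : J) : P j -> 0 <= (b%:R : R) <= 1.
  by move=> _; case: b; rewrite ?lexx ler01.
elim=> [|k IHk] j Pj /=; first exact: X01.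
have r1 := iter_range k (b01 (odd k)); have r2 := iter_range k (b01 (~~ odd k)).
rewrite negbK -fX //; apply/andP; split.
  by apply: Psi_anti => // i Pi; case/andP: (IHk i Pi).
by apply: Psi_anti => // i Pi; case/andP: (IHk i Pi).
Qed.

End Alternate.

(** * Selection probabilities on a hypertree with discrete labels *)

Section TreeRecursion.
Variables (R : realFieldType) (r d N : nat).

(** If [X j] is the probability of selection given label [j], this is the probability of being
    selected with a label below [i]. *)
Definition euler_sum (X : nat -> R) (i : nat) : R := N.+1%:R^-1 * \sum_(j < i) X j.

(** Given label [i], each of [m] child edges fails to block with probability [1 - p ^+ r], where [p]
    is the [euler_sum] of each of its [r] children. *)
Definition tree_step (m : nat) (X : nat -> R) (i : nat) : R := (1 - euler_sum X i ^+ r) ^+ m.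

(** The root has [d] child edges, one more than the inner vertices, and its label is averaged over
    all values. *)
Definition root_value (X : nat -> R) : R := euler_sum (tree_step d X) N.+1.

End TreeRecursion.

(** * The label recursion on a ball that is a hypertree *)

Section LabelledTree.
Variables (R : realFieldType) (G : hypergraph) (N r d : nat).
Hypotheses (unifG : uniform G r.+1) (regG : regular G d).
Local Notation V := (vertex G).
Local Notation L := {ffun V -> 'I_N.+1}.
Implicit Types (b : R) (l : L).

Lemma label_step_range (l : V -> nat) (X : V -> R) : (forall v, True -> 0 <= X v <= 1) ->
  forall v, True -> 0 <= label_step l X v <= 1.
Proof.
move=> X01 v _.
have p01 (e : {set V}) : 0 <= \prod_(w in e :\ v) ((l w < l v)%N%:R * X w) <= 1.
  have t01 w : 0 <= (l w < l v)%N%:R * X w <= 1.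
    by case/andP: (X01 w I) => X0 X1; case: leqP; rewrite ?mul0r ?mul1r ?lexx ?ler01 ?X0.
  apply/andP; split; first by apply: prodr_ge0 => w _; case/andP: (t01 w).
  by apply: prodr_ile1 => w _.
have f01 (e : {set V}) : 0 <= 1 - \prod_(w in e :\ v) ((l w < l v)%N%:R * X w) <= 1.
  by case/andP: (p01 e) => p0 p1; rewrite subr_ge0 p1 gerBl.
apply/andP; split; first by apply: prodr_ge0 => e _; case/andP: (f01 e).
by apply: prodr_ile1 => e _.
Qed.

Lemma label_step_anti (l : V -> nat) (X Y : V -> R) : (forall v, True -> 0 <= X v <= 1) ->
  (forall v, True -> 0 <= Y v <= 1) -> (forall v, True -> X v <= Y v) ->
  forall v, True -> label_step l Y v <= label_step l X v.
Proof.
move=> X01 Y01 XY v _; apply: ler_prod => e _; apply/andP; split.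
  rewrite subr_ge0; apply: prodr_ile1 => w _.
  by case/andP: (Y01 w I) => X0 X1; case: leqP; rewrite ?mul0r ?mul1r ?lexx ?ler01 ?X0.
rewrite lerB //; apply: ler_prod => w _.
case/andP: (X01 w I) => X0 _.
by rewrite mulr_ge0 //= ler_wpM2l ?XY.
Qed.

(* The selection recursion to depth [k] below [v], where the edge [e0] through
   which [v] was reached is not used again; [b] is the value at the leaves. *)
Fixpoint branch b (k : nat) (e0 : {set V}) (v : V) l : R :=
  if k is k'.+1 then
    \prod_(e in edges G | (v \in e) && (e != e0))
      (1 - \prod_(w in e :\ v) ((l w < l v)%N%:R * branch b k' e w l))
  else b.

(* The edge [e0] cannot block [v], since it contains a vertex with no smaller label. *)
Lemma iter_label_step b l k e0 v :
  (e0 \in edges G -> v \in e0 -> exists2 u, u \in e0 :\ v & (l v <= l u)%N) ->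
  iter k (label_step (fun v => l v)) (fun=> b) v = branch b k e0 v l.
Proof.
elim: k e0 v => //= k IHk e0 v He0; rewrite {1}/label_step.
have E (e : {set V}) : e \in edges G -> v \in e ->
    \prod_(w in e :\ v) ((l w < l v)%N%:R * iter k (label_step (fun v => l v)) (fun=> b) w) =
    \prod_(w in e :\ v) ((l w < l v)%N%:R * branch b k e w l).
  move=> eE ve; apply: eq_bigr => w; rewrite !inE => /andP[wv we].
  case: leqP => [|lwv]; first by rewrite !mul0r.
  by rewrite (IHk e) // => _ _; exists v; rewrite ?inE 1?eq_sym ?wv // ltnW.
have [/andP[e0E ve0]|ne0] := boolP ((e0 \in edges G) && (v \in e0)).
  rewrite (bigD1 e0) /= ?e0E //.
  have [u u0 lu] := He0 e0E ve0.
  rewrite [X in (1 - X) * _](bigD1 u) //= ltnNge lu !mul0r subr0 mul1r.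
  apply: eq_big => [e|e /andP[/andP[eE ve] _]]; first by rewrite andbA.
  by rewrite E.
apply: eq_big => [e|e /andP[eE ve]]; last by rewrite E.
case eE: (e \in edges G) => //=; case ve: (v \in e) => //=; apply/esym.
by apply: contra ne0 => /eqP <-; rewrite eE.
Qed.

Lemma branch_depends b k e v : depends_on (nbball k e v) (branch b k e v).
Proof.
elim: k e v => [//|k IHk] e v l l' ll /=.
have lv : l v = l' v by apply: ll; rewrite nbball_self.
apply: eq_bigr => e' /and3P[e'E ve' e'e]; congr (1 - _).
apply: eq_bigr => w wev.
have sub x : x \in nbball k e' w -> l x = l' x.
  move=> xB; apply: ll; rewrite /= in_setU1; apply/orP; right.
  apply/bigcupP; exists e'; first by rewrite e'E ve'.
  by apply/bigcupP; exists w.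
by rewrite lv (sub w) ?nbball_self // (IHk e' w l l').
Qed.

(** Once the label of [v] is fixed, the subtrees below [v] depend on disjoint sets of labels, so the
    average factorises over edges and over their vertices; each factor is evaluated by conditioning
    on the label of its top vertex. *)
Lemma avg_branch_node b k e0 v (i : 'I_N.+1) :
  (forall j, has_berge_cycle G j -> (k.+1.*2 < j)%N) ->
  (forall e w (j : 'I_N.+1), e \in edges G -> w \in e ->
    avg (fun l => branch b k e w (relabel w j l)) = iter k (tree_step r N d.-1) (fun=> b) j) ->
  avg (fun l => branch b k.+1 e0 v (relabel v i l)) =
  tree_step r N #|[set e in edges G | (v \in e) && (e != e0)]|
    (iter k (tree_step r N d.-1) (fun=> b)) i.
Proof.
move=> large IH; set q := iter k _ _.
have avgw e w : e \in edges G -> w \in e ->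
    avg (fun l => (l w < i)%N%:R * branch b k e w l) = euler_sum N q i.
  move=> eE we; rewrite (avg_relabel w) /euler_sum; congr (_ * _).
  transitivity (\sum_(j < N.+1) (if (j < i)%N then q j else 0)).
    apply: eq_bigr => j _.
    transitivity (avg (fun l => (j < i)%N%:R * branch b k e w (relabel w j l))).
      by apply: eq_avg => l; rewrite ffunE eqxx.
    by rewrite avgZ IH //; case: ifP; rewrite ?mul0r ?mul1r.
  rewrite -big_mkcond /= (big_ord_widen N.+1 q) //.
  exact/ltnW.
transitivity (avg (fun l => \prod_(e in edges G | (v \in e) && (e != e0))
      (1 - \prod_(w in e :\ v) ((l w < i)%N%:R * branch b k e w l)) : R)).
  apply: eq_avg => l /=; apply: eq_bigr => e /and3P[eE ve _]; congr (1 - _).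
  apply: eq_bigr => w; rewrite !inE => /andP[wv we]; rewrite !ffunE (negPf wv) eqxx.
  (* [v] lies outside the balls below it, so fixing its label does not affect the branches. *)
  congr (_ * _); apply: branch_depends => x xB; rewrite ffunE; case: eqP => // xv.
  by move: xB; rewrite xv (negPf (nbball_notin large eE ve we wv)).
have dep e w : depends_on (nbball k e w)
    (fun l => (l w < i)%N%:R * branch b k e w l).
  move=> l l' ll; rewrite (branch_depends b ll); congr ((_ < _)%N%:R * _).
  by rewrite ll // nbball_self.
have depe (e : {set V}) : depends_on (\bigcup_(w in e :\ v) nbball k e w)
    (fun l => \prod_(w in e :\ v) ((l w < i)%N%:R * branch b k e w l)).
  move=> l l' ll; apply: eq_bigr => w wev; apply: dep => x xB; apply: ll.
  by apply/bigcupP; exists w.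
rewrite (@avg_prod_cond _ _ _ _ _ (fun e => \bigcup_(w in e :\ v) nbball k e w)).
- rewrite /tree_step -prodr_const; apply: eq_big => [e|e /and3P[eE ve _]]; first by rewrite inE.
  rewrite avg_subr1; congr (1 - _).
  rewrite (@avg_prod_cond _ _ _ _ _ (fun w => nbball k e w)) //.
    rewrite (eq_bigr (fun=> euler_sum N q i)); last first.
      by move=> w; rewrite inE => /andP[_ we]; rewrite avgw.
    by rewrite prodr_const; congr (_ ^+ _); have := unifG eE; rewrite (cardsD1 v) ve => -[].
  move=> w w'; rewrite !inE => /andP[wv we] /andP[w'v w'e] ww'.
  apply: (nbball_disjoint large eE eE ve ve) => //.
  by rewrite xpair_eqE eqxx.
- by move=> e _ l l' ll; rewrite (depe e l l').
- move=> e e' /and3P[eE ve _] /and3P[e'E ve' _] ee'.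
  apply/pred0P => x /=; apply/negbTE/negP => /andP[/bigcupP[w]].
  rewrite !inE => /andP[wv we] xw /bigcupP[w']; rewrite !inE => /andP[w'v w'e] xw'.
  have : [disjoint nbball k e w & nbball k e' w'].
    by apply: (nbball_disjoint large eE e'E ve ve') => //; rewrite xpair_eqE negb_and ee'.
  by move/pred0P/(_ x); rewrite /= xw xw'.
Qed.

Lemma avg_branch b k e v (i : 'I_N.+1) :
  (forall j, has_berge_cycle G j -> (k.*2 < j)%N) -> e \in edges G -> v \in e ->
  avg (fun l => branch b k e v (relabel v i l)) = iter k (tree_step r N d.-1) (fun=> b) i.
Proof.
elim: k e v i => [|k IHk] e v i large eE ve; first by rewrite avg_cst.
rewrite avg_branch_node //; last first.
  by move=> e' w j e'E we'; apply: IHk => // m /large; lia.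
rewrite [RHS]/=; congr tree_step.
have := regG v; rewrite (cardsD1 e) !inE eE ve /= => <-; rewrite add1n /=.
by apply: eq_card => e'; rewrite !inE; case: (e' == e); rewrite ?andbF //= andbT.
Qed.

Lemma avg_root b k v :
  (forall j, has_berge_cycle G j -> (k.+1.*2 < j)%N) ->
  avg (fun l : L => iter k.+1 (label_step (fun v => l v)) (fun=> b) v) =
  root_value r d N (iter k (tree_step r N d.-1) (fun=> b)).
Proof.
move=> large.
(* The empty set is not an edge: excluding it keeps all [d] edges at the root and makes the premise
   of [iter_label_step] vacuous. *)
have e0 : (set0 : {set V}) \notin edges G := edges_nonempty G.
under eq_avg => l do rewrite (@iter_label_step b l k.+1 set0) ?(negPf e0) //.
rewrite (avg_relabel v) /root_value /euler_sum; congr (_ * _); apply: eq_bigr => i _.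
rewrite avg_branch_node //; last first.
  by move=> e' w j e'E we'; apply: avg_branch => // m /large; lia.
congr tree_step; rewrite -(regG v); apply: eq_card => e; rewrite !inE.
case eE: (e \in edges G) => //=; case: (v \in e) => //=.
by apply: contra e0 => /eqP <-.
Qed.

End LabelledTree.

(** * Mean value inequalities for powers *)

Section PowerBounds.
Variable R : realFieldType.
Implicit Types a b x y t : R.

Lemma power_diff_le x y t n : 0 <= x <= t -> 0 <= y <= t ->
  `|x ^+ n - y ^+ n| <= n%:R * t ^+ n.-1 * `|x - y|.
Proof.
move=> /andP[x0 xt] /andP[y0 yt]; have t0 := le_trans x0 xt.
rewrite subrXX normrM mulrC ler_wpM2r //; apply: le_trans (ler_norm_sum _ _ _) _.
rewrite -[X in X%:R](card_ord n) mulr_natl -sumr_const; apply: ler_sum => i _.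
have in1 : (i <= n.-1)%N by rewrite -ltnS prednK // (leq_trans _ (ltn_ord i)).
rewrite -{2}(subnK in1) exprD normrM !normrX !ger0_norm //.
by rewrite ler_pM ?exprn_ge0 // lerXn2r ?nnegrE.
Qed.

(** Each of the [n.+1] terms in the factorisation of the difference lies between [a ^+ n] and
    [b ^+ n]. This bound stands in for integrating powers. *)
Lemma power_diff_bounds a b n : 0 <= a -> a <= b ->
  n.+1%:R * a ^+ n * (b - a) <= b ^+ n.+1 - a ^+ n.+1 <= n.+1%:R * b ^+ n * (b - a).
Proof.
move=> a0 ab; have b0 := le_trans a0 ab.
rewrite subrXX mulrC [X in _ <= _ <= X]mulrC !ler_wpM2l ?subr_ge0 //=.
  rewrite -[X in X%:R](card_ord n.+1) mulr_natl -sumr_const; apply: ler_sum => i _.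
  have in1 : (i <= n)%N by rewrite -ltnS.
  have -> : b ^+ n = b ^+ (n - i) * b ^+ i by rewrite -exprD subnK.
  by rewrite ler_pM ?exprn_ge0 // lerXn2r ?nnegrE.
rewrite -[X in X%:R](card_ord n.+1) mulr_natl -sumr_const; apply: ler_sum => i _.
have in1 : (i <= n)%N by rewrite -ltnS.
have -> : a ^+ n = a ^+ (n - i) * a ^+ i by rewrite -exprD subnK.
by rewrite ler_pM ?exprn_ge0 // lerXn2r ?nnegrE.
Qed.

End PowerBounds.

(** * Decay of the tree recursion, and the Euler scheme as its fixed point *)

Section TreeBounds.
Variables (R : realFieldType) (r d N : nat).
Hypothesis r_gt0 : (0 < r)%N.
Local Notation h := (N.+1%:R^-1 : R).
Local Notation D := d.-1.
Implicit Types (X Y : nat -> R) (i j k : nat).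

Let h_gt0 : 0 < h. Proof. by rewrite invr_gt0 ltr0n. Qed.

Let ih_le1 i : (i <= N.+1)%N -> i%:R * h <= 1.
Proof. by move=> iN; rewrite ler_pdivrMr ?ltr0n // mul1r ler_nat. Qed.

Definition unit_range X := forall j, (j < N.+1)%N -> 0 <= X j <= 1.

Lemma euler_sum_range X i : unit_range X -> (i <= N.+1)%N ->
  0 <= euler_sum N X i <= i%:R * h.
Proof.
move=> X01 iN; rewrite /euler_sum mulrC pmulr_lge0 // ler_pM2r //; apply/andP; split.
  by apply: sumr_ge0 => j _; case/andP: (X01 j (leq_trans (ltn_ord j) iN)).
rewrite -[X in _ <= X%:R](card_ord i) -sumr_const.
by apply: ler_sum => j _; case/andP: (X01 j (leq_trans (ltn_ord j) iN)).
Qed.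

Lemma euler_sum_range1 X i : unit_range X -> (i <= N.+1)%N -> 0 <= euler_sum N X i <= 1.
Proof.
by move=> X01 iN; case/andP: (euler_sum_range X01 iN) => -> /le_trans-> //; apply: ih_le1.
Qed.

Let exp_range (x : R) m : 0 <= x <= 1 -> 0 <= x ^+ m <= 1.
Proof. by case/andP => x0 x1; rewrite exprn_ge0 ?exprn_ile1. Qed.

Let sub1_range (x : R) : 0 <= x <= 1 -> 0 <= 1 - x <= 1.
Proof. by case/andP => x0 x1; rewrite subr_ge0 x1 gerBl. Qed.

Lemma tree_step_range m X : unit_range X -> unit_range (tree_step r N m X).
Proof.
move=> X01 j jN; apply/exp_range/sub1_range/exp_range/euler_sum_range1 => //.
exact: ltnW.
Qed.

Lemma tree_step_anti m X Y : unit_range X -> unit_range Y ->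
  (forall j, (j < N.+1)%N -> X j <= Y j) ->
  forall j, (j < N.+1)%N -> tree_step r N m Y j <= tree_step r N m X j.
Proof.
move=> X01 Y01 XY j jN.
have /andP[eX0 _] := euler_sum_range1 X01 (ltnW jN).
have rY := euler_sum_range1 Y01 (ltnW jN); have /andP[eY0 _] := rY.
have XYj : euler_sum N X j <= euler_sum N Y j.
  rewrite /euler_sum ler_pM2l //; apply: ler_sum => i _; apply: XY.
  exact: ltn_trans (ltn_ord i) jN.
have /andP[Y0 _] := sub1_range (exp_range r rY).
have XYr : 1 - euler_sum N Y j ^+ r <= 1 - euler_sum N X j ^+ r.
  by rewrite lerB // lerXn2r ?nnegrE.
by rewrite lerXn2r ?nnegrE // (le_trans Y0).
Qed.

Lemma root_value_anti X Y : unit_range X -> unit_range Y ->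
  (forall j, (j < N.+1)%N -> X j <= Y j) -> root_value r d N Y <= root_value r d N X.
Proof.
move=> X01 Y01 XY; rewrite /root_value /euler_sum ler_pM2l //.
by apply: ler_sum => j _; apply: tree_step_anti.
Qed.

(** A left Riemann sum of an increasing function is at most its integral. *)
Lemma power_sum_le m i :
  h * \sum_(j < i) (j%:R * h) ^+ m <= (i%:R * h) ^+ m.+1 / m.+1%:R.
Proof.
rewrite ler_pdivlMr ?ltr0n //; elim: i => [|i IHi].
  by rewrite big_ord0 mulr0 mul0r mul0r expr0n.
rewrite big_ord_recr /= mulrDr mulrDl.
have /andP[+ _] : m.+1%:R * (i%:R * h) ^+ m * (i.+1%:R * h - i%:R * h) <=
    (i.+1%:R * h) ^+ m.+1 - (i%:R * h) ^+ m.+1 <=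
    m.+1%:R * (i.+1%:R * h) ^+ m * (i.+1%:R * h - i%:R * h).
  apply: power_diff_bounds; first by rewrite mulr_ge0 // ltW.
  by rewrite ler_pM2r // ler_nat.
have -> : i.+1%:R * h - i%:R * h = h by rewrite -mulrBl -natrB // subSnn mul1r.
move: IHi; set A := h * _ * _; set B := h * _ ^+ m * _.
have -> : m.+1%:R * (i%:R * h) ^+ m * h = B by rewrite /B; ring.
lra.
Qed.

(** One more level costs a factor [D] for the edges and [r] for the vertices of an edge, and
    integrating [t ^+ (k * r)] divides by [k * r + 1]. *)
Fixpoint decay_coef k : R :=
  if k is k'.+1 then r%:R * D%:R * decay_coef k' / (k * r).+1%:R else 1.

Lemma decay_coef_ge0 k : 0 <= decay_coef k.
Proof. by elim: k => //= k IHk; rewrite divr_ge0 ?mulr_ge0. Qed.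

Local Notation q b k := (iter k (tree_step r N D) (fun=> b%:R : R)).

Let q_range (b : bool) k : unit_range (q b k).
Proof.
by apply: (iter_range (P := fun j => (j < N.+1)%N)) => [X|j _];
  [apply: tree_step_range | case: b; rewrite ?lexx ler01].
Qed.

Lemma tree_step_diff m X Y i : unit_range X -> unit_range Y -> (i < N.+1)%N ->
  `|tree_step r N m X i - tree_step r N m Y i| <=
  m%:R * `|euler_sum N X i ^+ r - euler_sum N Y i ^+ r|.
Proof.
move=> X01 Y01 iN.
have HX := sub1_range (exp_range r (euler_sum_range1 X01 (ltnW iN))).
have HY := sub1_range (exp_range r (euler_sum_range1 Y01 (ltnW iN))).
apply: le_trans (power_diff_le m HX HY) _; rewrite expr1n mulr1.
have -> : 1 - euler_sum N X i ^+ r - (1 - euler_sum N Y i ^+ r) =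
  euler_sum N Y i ^+ r - euler_sum N X i ^+ r by ring.
by rewrite distrC.
Qed.

(** The exponent grows by [r] per level: [r - 1] from the difference of [r]-th powers and 1 from the
    summation over labels. *)
Lemma decay k i : (i <= N.+1)%N ->
  `|euler_sum N (q true k) i ^+ r - euler_sum N (q false k) i ^+ r| <=
  decay_coef k * (i%:R * h) ^+ (k.+1 * r).
Proof.
elim: k i => [|k IHk] i iN.
  rewrite /= mul1r mul1n /euler_sum big1_eq mulr0 expr0n gtn_eqF // subr0.
  by rewrite sumr_const card_ord -[_ *+ i]mulr_natl mulr1 mulrC ger0_norm // exprn_ge0 // mulr_ge0 // ltW.
have HX := euler_sum_range (q_range true k.+1) iN.
have HY := euler_sum_range (q_range false k.+1) iN.
apply: le_trans (power_diff_le r HX HY) _.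
have ih0 : 0 <= i%:R * h by rewrite mulr_ge0 // ltW.
have step : `|euler_sum N (q true k.+1) i - euler_sum N (q false k.+1) i| <=
    D%:R * decay_coef k * ((i%:R * h) ^+ (k.+1 * r).+1 / (k.+1 * r).+1%:R).
  rewrite /euler_sum -mulrBr -sumrB normrM gtr0_norm //.
  apply: le_trans (_ : h * \sum_(j < i) D%:R * (decay_coef k * (j%:R * h) ^+ (k.+1 * r)) <= _).
    rewrite ler_pM2l //; apply: le_trans (ler_norm_sum _ _ _) _; apply: ler_sum => j _.
    have jN := leq_trans (ltn_ord j) iN.
    apply: le_trans (tree_step_diff _ (q_range true k) (q_range false k) jN) _.
    by rewrite ler_wpM2l // IHk // ltnW.
  rewrite -!mulr_sumr mulrCA [h * _]mulrCA mulrA ler_wpM2l ?power_sum_le //.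
  by rewrite mulr_ge0 // decay_coef_ge0.
apply: le_trans (ler_wpM2l _ step) _; first by rewrite mulr_ge0 // exprn_ge0.
have -> : (k.+2 * r = r.-1 + (k.+1 * r).+1)%N by rewrite mulSn addnS -addSn prednK.
by rewrite exprD le_eqVlt; apply/orP; left; apply/eqP => /=; ring.
Qed.

Lemma root_decay k :
  `|root_value r d N (q true k) - root_value r d N (q false k)| <=
  d%:R * decay_coef k / (k.+1 * r).+1%:R.
Proof.
rewrite /root_value /euler_sum -mulrBr -sumrB normrM gtr0_norm //.
apply: le_trans (_ : h * \sum_(j < N.+1) d%:R * (decay_coef k * (j%:R * h) ^+ (k.+1 * r)) <= _).
  rewrite ler_pM2l //; apply: le_trans (ler_norm_sum _ _ _) _; apply: ler_sum => j _.
  apply: le_trans (tree_step_diff _ (q_range true k) (q_range false k) (ltn_ord j)) _.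
  by rewrite ler_wpM2l // decay // ltnW.
rewrite -!mulr_sumr mulrCA [h * _]mulrCA mulrA.
have c0 : 0 <= d%:R * decay_coef k by rewrite mulr_ge0 // decay_coef_ge0.
apply: le_trans (ler_wpM2l c0 (power_sum_le _ _)) _.
by rewrite mulfV ?pnatr_eq0 // expr1n div1r.
Qed.

(** Since [j * r + 1 = r * (j + 1 / r)], the powers of [r] cancel level by level and a single [r]
    remains. This is [epsilon] with [k] the integer part of [(g - 3) / 2]. *)
Lemma decay_coefE k :
  d%:R * decay_coef k / (k.+1 * r).+1%:R =
  (d * (d - 1) ^ k)%:R / (r%:R * \prod_(1 <= j < k.+2) (j%:R + r%:R^-1)).
Proof.
have r0 : r%:R != 0 :> R by rewrite pnatr_eq0 -lt0n.
have pos j : j%:R + r%:R^-1 != 0 :> R.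
  by rewrite gt_eqF // ltr_wpDl // invr_gt0 ltr0n.
have facE j : (j * r).+1%:R = r%:R * (j%:R + r%:R^-1) :> R.
  by rewrite mulrDr mulfV // -natrM mulnC natr1.
have E : decay_coef k * \prod_(1 <= j < k.+1) (j%:R + r%:R^-1) = D%:R ^+ k.
  elim: k => [|k IHk]; first by rewrite big_nil mulr1.
  rewrite big_nat_recr //= exprS -IHk facE.
  by field; rewrite r0 nat1r -natrM natr1 pnatr_eq0.
have p0 : \prod_(1 <= j < k.+1) (j%:R + r%:R^-1) != 0 :> R.
  by rewrite prodf_seq_neq0; apply/allP => j _ /=; apply: pos.
rewrite big_nat_recr //= subn1 natrM natrX -E facE.
move: (pos k.+1) p0; set P := \prod_(1 <= _ < _) _; set Q := (_ + _) => Q0 P0.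
by field; rewrite r0 Q0 P0.
Qed.

Fixpoint euler i : R :=
  if i is i'.+1 then euler i' + h * (1 - euler i' ^+ r) ^+ D else 0.

(** Makes the slopes of the scheme a fixed point of [tree_step r N D]. *)
Lemma euler_sumE i : euler_sum N (fun j => (1 - euler j ^+ r) ^+ D) i = euler i.
Proof.
rewrite /euler_sum; elim: i => [|i IHi]; first by rewrite big_ord0 mulr0.
by rewrite big_ord_recr mulrDr IHi.
Qed.

Lemma euler_le i : (i <= N.+1)%N -> 0 <= euler i <= i%:R * h.
Proof.
elim: i => [|i IHi] iN; first by rewrite mul0r lexx.
have /andP[e0 ei] := IHi (ltnW iN).
have e1 := le_trans ei (ih_le1 (ltnW iN)).
have /andP[s0 s1] : 0 <= (1 - euler i ^+ r) ^+ D <= 1.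
  by apply/exp_range/sub1_range/exp_range; rewrite e0.
rewrite /= addr_ge0 ?mulr_ge0 ?(ltW h_gt0) //= -[i.+1%:R]natr1 mulrDl mul1r lerD //.
by rewrite ler_piMr // ltW.
Qed.

Lemma euler_range i : (i <= N.+1)%N -> 0 <= euler i <= 1.
Proof. by move=> iN; case/andP: (euler_le iN) => -> /le_trans-> //; apply: ih_le1. Qed.

Definition euler_root : R := root_value r d N (fun j => (1 - euler j ^+ r) ^+ D).

(** The slopes obey [iter_sandwich]; [root_value] is antitone and exchanges the bounds once more,
    hence the opposite parity. *)
Lemma euler_root_sandwich k :
  root_value r d N (q (~~ odd k) k) <= euler_root <= root_value r d N (q (odd k) k).
Proof.
have p01 : unit_range (fun j => (1 - euler j ^+ r) ^+ D).
  by move=> j jN; apply/exp_range/sub1_range/exp_range/euler_range/ltnW.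
have fp j : (j < N.+1)%N -> tree_step r N D (fun j => (1 - euler j ^+ r) ^+ D) j = (1 - euler j ^+ r) ^+ D.
  by move=> _; rewrite /tree_step euler_sumE.
have S := iter_sandwich (P := fun j => (j < N.+1)%N) (@tree_step_range D) (@tree_step_anti D) p01 fp k.
by apply/andP; split; apply: root_value_anti => // j /S /andP[].
Qed.

End TreeBounds.

(** * Comparison of the greedy algorithm with the Euler scheme *)

Section GreedyEuler.
Variables (R : realFieldType) (G : hypergraph) (r d k : nat).
Hypotheses (r_gt0 : (0 < r)%N) (unifG : uniform G r.+1) (regG : regular G d).
Hypothesis large_girth : forall j, has_berge_cycle G j -> (k.+1.*2 < j)%N.
Local Notation V := (vertex G).
Local Notation n := #|V|.
Local Notation E := (greedy_expected_size R G).

Lemma greedy_value_ge0 (S Q : {set V}) : 0 <= greedy_value R S Q.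
Proof.
have [m] := ubnP #|Q|; elim: m S Q => // m IHm S Q; rewrite ltnS => Qm.
have [->|Q0] := eqVneq Q set0; first by rewrite greedy_value0.
have cQ : 0 < #|Q|%:R :> R by rewrite ltr0n card_gt0.
rewrite -(pmulr_rge0 _ cQ) greedy_valueS; apply: sumr_ge0 => v vQ; apply: IHm.
exact: leq_trans (card_greedy_next S vQ) Qm.
Qed.

Lemma independent_small (S : {set V}) : (#|S| <= r)%N -> independent S.
Proof.
move=> Sr; apply/existsP => -[e /andP[eE /subset_leq_card]].
by rewrite (unifG eE); lia.
Qed.

Lemma greedy_le_alpha : E <= (alpha G)%:R.
Proof.
apply: greedy_value_le_alpha; first by apply: independent_small; rewrite cards0.
by move=> w _; rewrite setU0; apply: independent_small; rewrite cards1.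
Qed.

Lemma alpha_le : (alpha G <= n)%N.
Proof. by apply/bigmax_leqP => S _; apply: max_card. Qed.

(** The analogue of a union bound over pairs of equal labels, with the crude count [m ^ 2] and
    multiplied through by [N] to stay within natural numbers. *)
Lemma ffact_lower (N m : nat) : (N ^ m * N <= N ^_ m * N + m ^ 2 * N ^ m)%N.
Proof.
elim: m => [|m IHm]; first by rewrite ffactn0 expn0; lia.
have Fle : (N ^_ m <= N ^ m)%N.
  elim: m {IHm} => // m IHm; by rewrite ffactnSr expnSr; apply: leq_mul; rewrite ?leq_subr.
rewrite ffactnSr expnSr.
have : (N ^_ m * N <= N ^_ m * (N - m) + m * N ^ m)%N.
  have : (N ^_ m * N <= N ^_ m * (N - m + m))%N by rewrite leq_mul //; lia.
  by rewrite mulnDr [(N ^_ m * m)%N]mulnC; have := leq_mul (leqnn m) Fle; lia.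
by nia.
Qed.

Section Labels.
Variable N : nat.
Local Notation L := {ffun V -> 'I_N.+1}.

Lemma noninjective_le :
  1 - #|[pred l : L | injectiveb l]|%:R / #|{: L}|%:R <= (n ^ 2)%:R / N.+1%:R :> R.
Proof.
have D0 : 0 < #|{: L}|%:R :> R := card_labels_gt0 _ _ _.
rewrite ler_pdivlMr ?ltr0n // mulrBl mul1r mulrAC lerBlDr -lerBlDl.
rewrite -(ler_pM2r D0) mulrBl divfK ?gt_eqF // lerBlDl.
have -> : #|[pred l : L | injectiveb l]| = (N.+1 ^_ n)%N.
  by rewrite -[N.+1 in RHS]card_ord -card_inj_ffuns cardsE.
by rewrite card_ffun card_ord -!natrM -natrD ler_nat mulnC; have := ffact_lower N.+1 n; lia.
Qed.

(** Both quantities lie between [n] times the same two root values, up to the effect of ties; the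
    first error term bounds the gap between these values. *)
Lemma greedy_near_euler :
  `|E - n%:R * euler_root R r d N| <=
  n%:R * (d%:R * decay_coef R r d k / (k.+1 * r).+1%:R) + n%:R * ((n ^ 2)%:R / N.+1%:R).
Proof.
(* [x] is the probability that the labels are distinct. *)
set x := #|[pred l : L | injectiveb l]|%:R / #|{: L}|%:R : R.
have D0 : 0 < #|{: L}|%:R :> R := card_labels_gt0 _ _ _.
have x0 : 0 <= x by rewrite divr_ge0.
have x1 : x <= 1 by rewrite ler_pdivrMr // mul1r ler_nat max_card.
have E0 : 0 <= E by apply: greedy_value_ge0.
have En : E <= n%:R by apply: le_trans greedy_le_alpha _; rewrite ler_nat alpha_le.
pose U (b : bool) (l : L) v : R := iter k.+1 (label_step (fun v => l v)) (fun=> b%:R) v.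
have U01 b l v : 0 <= U b l v <= 1.
  apply: (iter_range (P := fun=> True)) => //; first exact: label_step_range.
  by move=> _ _; case: b; rewrite ?lexx ler01.
have sandwich (t : #|V|.-tuple V) (l : L) : uniq t -> increasing l t ->
    \sum_v U (~~ odd k) l v <= #|greedy_run set0 t|%:R <= \sum_v U (odd k) l v.
  move=> ut it.
  have -> : #|greedy_run set0 t|%:R = \sum_v (v \in greedy_run set0 t)%:R :> R.
    by rewrite -natr_sum -sum1_card big_mkcond; congr _%:R; apply: eq_bigr => v _; case: ifP.
  pose X v : R := (v \in greedy_run set0 t)%:R.
  have X01 v : True -> 0 <= X v <= 1 by rewrite /X; case: (v \in _); rewrite ?lexx ler01.
  have fX v : True -> label_step (fun v => l v) X v = X v.
    by move=> _; apply: greedy_run_fixed => // w; apply: uniq_tuple_all.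
  have S v := iter_sandwich (@label_step_range R G _) (@label_step_anti R G _) X01 fX k.+1 (j := v) I.
  by apply/andP; split; apply: ler_sum => v _; case/andP: (S v); rewrite /= ?negbK.
have ind1 (v : V) : independent [set v] by apply: independent_small; rewrite cards1.
have xE : x * E = #|{: L}|%:R^-1 * \sum_(t : #|V|.-tuple V | uniq t)
    \sum_(l : L | increasing l t) #|greedy_run set0 t|%:R.
  by rewrite -greedy_value_labels // /x mulrAC [in RHS]mulrC.
have rootE b : #|{: L}|%:R^-1 * \sum_(l : L) \sum_v U b l v =
    n%:R * root_value r d N (iter k (tree_step r N d.-1) (fun=> b%:R)).
  rewrite -[LHS]/(avg _) avg_sum.
  under eq_bigr => v _ do rewrite (avg_root _ unifG regG _ _ large_girth).
  by rewrite sumr_const mulr_natl.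
have up : x * E <= n%:R * root_value r d N (iter k (tree_step r N d.-1) (fun=> (odd k)%:R)).
  rewrite xE -rootE ler_pM2l ?invr_gt0 //.
  apply: le_trans (_ : \sum_(l : L | injectiveb l) \sum_v U (odd k) l v <= _).
    rewrite -sum_increasing; apply: ler_sum => t ut; apply: ler_sum => l it.
    by case/andP: (sandwich t l ut it).
  rewrite [leRHS](bigID (fun l : L => injectiveb l)) /= lerDl; apply: sumr_ge0 => l _.
  by apply: sumr_ge0 => v _; case/andP: (U01 (odd k) l v).
(* A labelling with a tie accounts for at most [n] in the lower iterate, hence the correction by the
   tie probability [1 - x]. *)
have low : n%:R * root_value r d N (iter k (tree_step r N d.-1) (fun=> (~~ odd k)%:R))
    - n%:R * (1 - x) <= x * E.
  have -> : n%:R * (1 - x) = #|{: L}|%:R^-1 * \sum_(l : L | ~~ injectiveb l) n%:R :> R.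
    have cc : #|{: L}|%:R = #|[pred l : L | injectiveb l]|%:R + #|[pred l : L | ~~ injectiveb l]|%:R :> R.
      by rewrite -natrD -(cardC [pred l : L | injectiveb l]); congr (_ + _)%:R; apply: eq_card.
    rewrite sumr_const -[n%:R *+ _]mulr_natl mulrA mulrC; congr (_ * _).
    by rewrite /x cc; field; rewrite -cc lt0r_neq0.
  rewrite xE -rootE -mulrBr ler_pM2l ?invr_gt0 // lerBlDr.
  rewrite (bigID (fun l : L => injectiveb l)) /= lerD //.
    rewrite -sum_increasing; apply: ler_sum => t ut; apply: ler_sum => l it.
    by case/andP: (sandwich t l ut it).
  apply: ler_sum => l _; rewrite -sumr_const.
  by apply: ler_sum => v _; case/andP: (U01 (~~ odd k) l v).
have /andP[es1 es2] := euler_root_sandwich R r d N k.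
have eps := root_decay R d N r_gt0 k.
have del := noninjective_le; rewrite -/x in del.
move: up low es1 es2 eps.
set eu := euler_root R r d N; set A := root_value _ _ _ _; set B := root_value _ _ _ _.
move=> up low es1 es2 eps.
set ep := (X in _ <= X) in eps *.
have AB : A - B <= ep.
  apply: le_trans eps; rewrite /A /B; case: (odd k); first exact: ler_norm.
  by rewrite distrC ler_norm.
have n0 : 0 <= n%:R :> R by [].
have nAB := ler_wpM2l n0 AB; have ndel := ler_wpM2l n0 del.
have nes1 := ler_wpM2l n0 es1; have nes2 := ler_wpM2l n0 es2.
(* [E - x * E] lies between 0 and [n * (1 - x)], which allows passing from [x * E] to [E]. *)
have xE1 : x * E <= E by rewrite ler_piMl.
have xE2 : E * (1 - x) <= n%:R * (1 - x) by rewrite ler_wpM2r // subr_ge0.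
move: up low nAB ndel nes1 nes2 xE1 xE2; rewrite !mulrBr !mulr1 [E * x]mulrC.
rewrite ler_norml -/ep; clear.
move: (n%:R * ep) (n%:R * (_ / _)) (x * E) (n%:R * x) (n%:R * A) (n%:R * B) (n%:R * eu).
by move=> *; lra.
Qed.

End Labels.
End GreedyEuler.

From mathcomp Require Import all_classical all_reals all_analysis.
Import numFieldNormedType.Exports.
Local Open Scope ring_scope.

(** * The negative binomial series *)

Section NegativeBinomial.
Variable R : realType.
Local Open Scope classical_set_scope.

Definition negbin (k : nat) (y : R) : R^nat := fun n => 'C(n + k, k)%:R * y ^+ n.

(** Pascal's rule: multiplying by [1 - y] lowers the order by one, up to a boundary term. *)
Lemma negbin_seriesS k y m :
  (1 - y) * series (negbin k.+1 y) m = series (negbin k y) m - 'C(m + k, k.+1)%:R * y ^+ m.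
Proof.
rewrite !seriesEnat /=; elim: m => [|m IHm].
  by rewrite !big_geq // mulr0 ?add0n bin_small // mul0r subrr.
rewrite !big_nat_recr //= mulrDr IHm /negbin addSn addnS binS natrD exprS; ring.
Qed.

Lemma nondecreasing_negbin k y : 0 <= y -> nondecreasing_seq (series (negbin k y)).
Proof.
move=> y0; apply: nondecreasing_series => n _ _.
by rewrite mulr_ge0 // exprn_ge0.
Qed.

Lemma cvg_negbin k y : 0 <= y < 1 ->
  series (negbin k y) @ \oo --> ((1 - y) ^+ k.+1)^-1.
Proof.
move=> /andP[y0 y1]; have s0 : 0 < 1 - y by rewrite subr_gt0.
elim: k => [|k IHk].
  have -> : negbin 0 y = geometric 1 y.
    by apply/funext => n; rewrite /negbin /geometric /= addn0 bin0.
  rewrite expr1 -[X in _ --> X]mul1r; apply: cvg_geometric_series.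
  by rewrite ger0_norm.
have cvgS : cvgn (series (negbin k.+1 y)).
  apply: nondecreasing_is_cvgn; first exact: nondecreasing_negbin.
  exists ((1 - y) ^+ k.+2)^-1 => _ [m _ <-].
  rewrite exprS invfM -ler_pdivrMl ?invr_gt0 // invrK negbin_seriesS.
  apply: le_trans (_ : series (negbin k y) m <= _).
    by rewrite gerBl mulr_ge0 // exprn_ge0.
  rewrite -(cvg_lim _ IHk) //; apply: nondecreasing_cvgn_le; first exact: nondecreasing_negbin.
  by apply/cvg_ex; exists ((1 - y) ^+ k.+1)^-1.
(* The boundary term is dominated by the general term of a series already known to converge. *)
have t0 : (fun m => 'C(m + k, k.+1)%:R * y ^+ m) @ \oo --> (0 : R).
  apply: (squeeze_cvgr (f := fun=> 0) (h := negbin k.+1 y)).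
  - near=> m; rewrite mulr_ge0 ?exprn_ge0 //= ler_wpM2r ?exprn_ge0 // ler_nat.
    by rewrite addnS leq_bin2l.
  - exact: cvg_cst.
  - exact: cvg_series_cvg_0.
have -> : series (negbin k.+1 y) =
    (fun m => (series (negbin k y) m - 'C(m + k, k.+1)%:R * y ^+ m) * (1 - y)^-1).
  by apply/funext => m; rewrite -negbin_seriesS mulrC mulKf ?gt_eqF.
have -> : ((1 - y) ^+ k.+2)^-1 = (((1 - y) ^+ k.+1)^-1 - 0) * (1 - y)^-1.
  by rewrite subr0 exprSr invfM.
by apply: cvgMr_tmp; apply: cvgB.
Unshelve. all: by end_near.
Qed.

End NegativeBinomial.

(** * The series defining [u]: its sum, existence and uniqueness of the root *)

Section USeries.
Variables (R : realType) (k r : nat).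
Hypothesis r_gt0 : (0 < r)%N.
Local Open Scope classical_set_scope.
Local Notation S := (u_series k.+2 r : R -> R^nat).
Implicit Types a b x : R.

(* The derivative of the sum of [u_series]. *)
Definition u_density x : R := ((1 - x ^+ r) ^+ k.+1)^-1.

Lemma u_seriesE x :
  S x = series (fun n => 'C(n + k, k)%:R * (x ^+ (r * n).+1 / (r * n).+1%:R)).
Proof. by rewrite /u_series; congr series; apply/funext => n; rewrite addn1 -addnBA // !subSS !subn0. Qed.

(** Mean value bound term by term; the differentiated series is [negbin k] at the [r]-th power. *)
Lemma u_series_diff a b m : 0 <= a -> a <= b ->
  (b - a) * series (negbin k (a ^+ r)) m <= S b m - S a m <= (b - a) * series (negbin k (b ^+ r)) m.
Proof.
move=> a0 ab; rewrite !u_seriesE !seriesEnat /= -sumrB !mulr_sumr.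
have bnd n : (b - a) * negbin k (a ^+ r) n <=
    'C(n + k, k)%:R * (b ^+ (r * n).+1 / (r * n).+1%:R) - 'C(n + k, k)%:R * (a ^+ (r * n).+1 / (r * n).+1%:R)
    <= (b - a) * negbin k (b ^+ r) n.
  rewrite /negbin -!exprM -mulrBr -mulrBl ![(b - a) * _]mulrCA.
  rewrite !ler_wpM2l // ?ler_pdivlMr ?ler_pdivrMr ?ltr0n //.
  + by have /andP[_] := power_diff_bounds (r * n) a0 ab; rewrite -mulrA mulrC [b ^+ _ * _]mulrC.
  + by have /andP[+ _] := power_diff_bounds (r * n) a0 ab; rewrite -mulrA mulrC [a ^+ _ * _]mulrC.
by apply/andP; split; apply: ler_sum => n _; case/andP: (bnd n).
Qed.

Lemma u_series0 m : S 0 m = 0.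
Proof. by rewrite u_seriesE seriesEnat /= big1 // => n _; rewrite exprS mul0r mul0r mulr0. Qed.

Lemma nondecreasing_u_series x : 0 <= x -> nondecreasing_seq (S x).
Proof.
move=> x0; rewrite u_seriesE; apply: nondecreasing_series => n _ _.
by rewrite mulr_ge0 // divr_ge0 // exprn_ge0.
Qed.

Lemma exp_lt1 x : 0 <= x < 1 -> 0 <= x ^+ r < 1.
Proof. by case/andP => x0 x1; rewrite exprn_ge0 // exprn_ilt1 // -lt0n. Qed.

Lemma is_cvg_u_series x : 0 <= x < 1 -> cvgn (S x).
Proof.
move=> x01; have /andP[x0 x1] := x01.
apply: nondecreasing_is_cvgn; first exact: nondecreasing_u_series.
exists (x * u_density x) => _ [m _ <-].
have /andP[_] := u_series_diff m (lexx 0) x0; rewrite u_series0 !subr0 => /le_trans; apply.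
have nb := cvg_negbin (k := k) (exp_lt1 x01).
rewrite ler_wpM2l // /u_density -(cvg_lim _ nb) //; apply: nondecreasing_cvgn_le.
  by apply: nondecreasing_negbin; rewrite exprn_ge0.
by apply/cvg_ex; eexists; exact: nb.
Qed.

Definition u_sum x : R := limn (S x).

Lemma cvg_u_sum x : 0 <= x < 1 -> S x @ \oo --> u_sum x.
Proof. by move=> /is_cvg_u_series. Qed.

Lemma u_sum_diff a b : 0 <= a -> a <= b -> b < 1 ->
  (b - a) * u_density a <= u_sum b - u_sum a <= (b - a) * u_density b.
Proof.
move=> a0 ab b1; have a01 : 0 <= a < 1 by rewrite a0 (le_lt_trans ab).
have b01 : 0 <= b < 1 by rewrite b1 (le_trans a0).
have cd : (S b \- S a) @ \oo --> u_sum b - u_sum a.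
  by apply: cvgB; apply: cvg_u_sum.
have ca := cvg_negbin (k := k) (exp_lt1 a01); have cb := cvg_negbin (k := k) (exp_lt1 b01).
apply/andP; split.
  apply: (ler_cvg_to (cvgMl_tmp (a := b - a) ca) cd); near=> m.
  by have /andP[] := u_series_diff m a0 ab.
apply: (ler_cvg_to cd (cvgMl_tmp (a := b - a) cb)); near=> m.
by have /andP[] := u_series_diff m a0 ab.
Unshelve. all: by end_near.
Qed.

Lemma u_sum0 : u_sum 0 = 0.
Proof.
rewrite /u_sum (_ : S 0 = fun=> 0); first exact: lim_cst.
by apply/funext => m; rewrite u_series0.
Qed.

Lemma u_density_ge1 x : 0 <= x < 1 -> 1 <= u_density x.
Proof.
move=> x01; have /andP[y0 y1] := exp_lt1 x01.
rewrite invf_ge1 ?exprn_gt0 ?subr_gt0 // exprn_ile1 ?subr_ge0 ?gerBl // ltW //.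
Qed.

Lemma u_sum_lt a b : 0 <= a -> a < b -> b < 1 -> u_sum a < u_sum b.
Proof.
move=> a0 ab b1; have /andP[+ _] := u_sum_diff a0 (ltW ab) b1.
rewrite -subr_gt0; apply: lt_le_trans.
rewrite mulr_gt0 ?subr_gt0 // (lt_le_trans ltr01) // u_density_ge1 //.
by rewrite a0 (lt_trans ab).
Qed.

(* On [1 - 2^-j, 1 - 2^-(j+1)] the density is at least [2^j / r]. *)
Lemma u_sum_dyadic j : j%:R / (2 * r%:R) <= u_sum (1 - 2^-1 ^+ j).
Proof.
elim: j => [|j IHj]; first by rewrite expr0 subrr u_sum0 mul0r.
set p := 2^-1 ^+ j in IHj *; have p0 : 0 < p by rewrite exprn_gt0.
have p1 : p <= 1 by rewrite exprn_ile1 // invf_le1 // ler1n.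
have a0 : 0 <= 1 - p by rewrite subr_ge0.
have rr : 0 < r%:R :> R by rewrite ltr0n.
have pS : 2^-1 ^+ j.+1 = p / 2 by rewrite exprSr.
have diff : (1 - p / 2 - (1 - p)) * u_density (1 - p) <= u_sum (1 - p / 2) - u_sum (1 - p).
  have ab : 1 - p <= 1 - p / 2 by lra.
  have b1 : 1 - p / 2 < 1 by lra.
  by have /andP[] := u_sum_diff a0 ab b1.
have a1 : 1 - p < 1 by lra.
have a01 : 0 <= 1 - p < 1 by rewrite a0.
have /andP[y0 y1] := exp_lt1 a01.
(* Bernoulli's inequality gives [1 - (1 - p) ^+ r <= r * p], and further powers of a number in
   [[0, 1]] only decrease it. *)
have dens : (r%:R * p)^-1 <= u_density (1 - p).
  have : 1 - (1 - p) ^+ r <= r%:R * p.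
    have := @power_diff_le R 1 (1 - p) 1 r; rewrite lexx ler01 a0 (ltW a1) => /(_ isT isT).
    rewrite !expr1n mulr1 ger0_norm ?subr_ge0 ?(ltW y1) // ger0_norm; last by lra.
    by rewrite opprB addrCA subrr addr0.
  have q0 : 0 < 1 - (1 - p) ^+ r by rewrite subr_gt0.
  move=> le; rewrite /u_density lef_pV2 ?posrE ?mulr_gt0 ?exprn_gt0 //.
  apply: le_trans le; by rewrite exprS ler_piMr ?(ltW q0) // exprn_ile1 ?(ltW q0) // gerBl.
have half : (1 - p / 2 - (1 - p)) * (r%:R * p)^-1 = (2 * r%:R)^-1.
  by field; rewrite !gt_eqF.
have len : 0 <= 1 - p / 2 - (1 - p) by lra.
have step := ler_wpM2l len dens; rewrite half in step.
rewrite pS -[j.+1%:R]natr1 mulrDl mul1r; have := le_trans step diff; move: IHj.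
by set A := _ / _; set B := _^-1; set C := u_sum _; set C' := u_sum _; clear; lra.
Qed.

Lemma u_sum_lipschitz a b : 0 <= a -> a <= b -> b < 1 ->
  u_sum b - u_sum a <= (b - a) * u_density b.
Proof. by move=> a0 ab b1; have /andP[] := u_sum_diff a0 ab b1. Qed.

Lemma u_density_le a b : 0 <= a -> a <= b -> b < 1 -> u_density a <= u_density b.
Proof.
move=> a0 ab b1; have b01 : 0 <= b < 1 by rewrite b1 (le_trans a0).
have a01 : 0 <= a < 1 by rewrite a0 (le_lt_trans ab).
have /andP[_ ya] := exp_lt1 a01; have /andP[_ yb] := exp_lt1 b01.
rewrite lef_pV2 ?posrE ?exprn_gt0 ?subr_gt0 //.
rewrite lerXn2r ?nnegrE ?subr_ge0 ?(ltW ya) ?(ltW yb) // lerB //.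
by rewrite lerXn2r ?nnegrE // (le_trans a0).
Qed.

Lemma u_exists : exists x : R, 0 < x < 1 /\ u_sum x = 1.
Proof.
(* With exponent [2 * r] the lower bound of [u_sum_dyadic] equals 1. *)
set x1 : R := 1 - 2^-1 ^+ (2 * r).
have p0 : 0 < 2^-1 ^+ (2 * r) :> R by rewrite exprn_gt0.
have p1 : 2^-1 ^+ (2 * r) <= 1 :> R by rewrite exprn_ile1 // invf_le1 // ler1n.
have x10 : 0 <= x1 by rewrite subr_ge0.
have x11 : x1 < 1 by rewrite /x1 ltrBlDr ltrDl.
have Sx1 : 1 <= u_sum x1.
  have := u_sum_dyadic (2 * r); rewrite natrM mulfV //.
  by rewrite mulf_neq0 // pnatr_eq0 -lt0n.
pose A := [set x | 0 <= x <= x1 /\ u_sum x <= 1].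
have A0 : A 0 by split; rewrite ?lexx ?u_sum0.
have ubA : has_ubound A by exists x1 => x [/andP[]].
set s := sup A.
have s0 : 0 <= s by apply: ub_le_sup.
have s1 : s <= x1 by apply: ge_sup => [|x [/andP[]]]; first by exists 0.
have s11 : s < 1 by apply: le_lt_trans x11.
set K := u_density x1.
have K1 : 1 <= K by apply: u_density_ge1; rewrite x10.
have K0 : 0 < K by apply: lt_le_trans K1.
have lip a b : 0 <= a -> a <= b -> b <= x1 -> u_sum b - u_sum a <= (b - a) * K.
  move=> a0 ab b1; apply: le_trans (u_sum_lipschitz a0 ab (le_lt_trans b1 x11)) _.
  by rewrite ler_wpM2l ?subr_ge0 // u_density_le // (le_trans a0).
have S1 : u_sum s = 1.
  (* By the Lipschitz bound, a value above 1 at [s] would give a smaller upper bound of [A], and a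
     value below 1 a point of [A] beyond [s]. *)
  apply/eqP; rewrite eq_le; apply/andP; split; rewrite leNgt; apply/negP => ne.
    have : s <= s - (u_sum s - 1) / K.
      apply: ge_sup => [|x [/andP[x0 xx1] Sx]]; first by exists 0.
      have xs : x <= s by apply: ub_le_sup => //; split; rewrite ?x0 ?xx1.
      have := lip _ _ x0 xs s1; rewrite lerBrDr -lerBrDl ler_pdivrMr //; lra.
    by rewrite leNgt gtrBl divr_gt0 // subr_gt0.
  have sx1 : s < x1.
    rewrite lt_neqAle s1 andbT; apply/eqP => E; move: ne; rewrite E; lra.
  set y := Num.min x1 (s + (1 - u_sum s) / K).
  have sy : s < y by rewrite lt_min sx1 ltrDl divr_gt0 // subr_gt0.
  have yx1 : y <= x1 by rewrite ge_min lexx.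
  have : y <= s.
    apply: ub_le_sup => //; split; first by rewrite yx1 andbT (le_trans s0) // ltW.
    have : (y - s) * K <= 1 - u_sum s.
      by rewrite -ler_pdivlMr // lerBlDl ge_min lexx orbT.
    by have := lip _ _ s0 (ltW sy) yx1; lra.
  by rewrite leNgt sy.
exists s; split=> //; rewrite s11 andbT lt_neqAle s0 andbT; apply/eqP => E.
by move: S1; rewrite -E u_sum0; lra.
Qed.

Lemma u_unique x : 0 < x < 1 -> u_sum x = 1 -> unique (is_u k.+2 r) x.
Proof.
move=> /andP[x0 x1] Sx; have x01 : 0 <= x < 1 by rewrite x1 ltW.
split; first by split=> //; rewrite -Sx; apply: cvg_u_sum.
move=> y [y0 cy].
(* If [y >= 1], the partial sums at [y] dominate those at a point [z] strictly between [x] and 1, so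
   [u_sum z <= 1], against strict monotonicity. *)
have y1 : y < 1.
  rewrite ltNge; apply/negP => y1.
  set z := (x + 1) / 2; have xz : x < z by rewrite /z; lra.
  have z1 : z < 1 by rewrite /z; lra.
  have : u_sum z <= 1.
    apply: (ler_cvg_to (cvg_u_sum _) cy); first by rewrite z1 (le_trans (ltW x0)) // ltW.
    near=> m; rewrite -subr_ge0.
    have z0 : 0 <= z by rewrite (le_trans (ltW x0)) // ltW.
    have zy : z <= y by apply: le_trans y1; apply: ltW.
    have /andP[+ _] := u_series_diff m z0 zy; apply: le_trans.
    rewrite mulr_ge0 ?subr_ge0 // seriesEnat /=; apply: sumr_ge0 => n _.
    by rewrite mulr_ge0 // !exprn_ge0.
  by rewrite leNgt -{1}Sx u_sum_lt // ltW.
have y01 : 0 <= y < 1 by rewrite y1 ltW.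
have Sy : u_sum y = 1 by apply/cvg_lim.
have [xy|yx|//] := ltgtP x y.
  by have := u_sum_lt (ltW x0) xy y1; rewrite Sx Sy ltxx.
by have := u_sum_lt (ltW y0) yx x1; rewrite Sx Sy ltxx.
Unshelve. all: by end_near.
Qed.

Lemma u_spec : (0 < u R k.+2 r < 1) /\ u_sum (u R k.+2 r) = 1.
Proof.
have [x [x01 Sx]] := u_exists; have [ux uniq_x] := u_unique x01 Sx.
have isu : is_u k.+2 r (u R k.+2 r) by apply: getPex; exists x.
by rewrite -(uniq_x _ isu).
Qed.

End USeries.

(** * Convergence of the Euler scheme *)

Section EulerLimit.
Variables (R : realType) (k r N : nat).
Hypothesis r_gt0 : (0 < r)%N.
Local Notation h := (N.+1%:R^-1 : R).
Local Notation a := (euler R r k.+2 N).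
Local Notation u := (u R k.+2 r).
Local Notation c := ((1 + u) / 2).
Local Notation density := (@u_density R k r).
Local Notation K := (density c).

Let h_gt0 : 0 < h. Proof. by rewrite invr_gt0 ltr0n. Qed.

Lemma euler_step i : (i <= N.+1)%N -> a i <= a i.+1 <= a i + h.
Proof.
move=> iN; have /andP[a0 a1] := euler_range R r k.+2 iN.
have s0 : 0 <= 1 - a i ^+ r by rewrite subr_ge0 exprn_ile1.
rewrite /= lerDl lerD2l mulr_ge0 ?exprn_ge0 ?(ltW h_gt0) //= ler_piMr ?(ltW h_gt0) //.
by rewrite exprn_ile1 // gerBl exprn_ge0.
Qed.

(** The density is the reciprocal of the slope of the scheme. *)
Lemma euler_step_density i : (i <= N.+1)%N -> a i < 1 -> (a i.+1 - a i) * density (a i) = h.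
Proof.
move=> iN a1; have /andP[a0 _] := euler_range R r k.+2 iN.
rewrite /= addrAC subrr add0r mulfK // expf_neq0 // subr_eq0 eq_sym.
by rewrite lt_eqF // exprn_ilt1 // -lt0n.
Qed.

(* [u_sum] straightens the scheme: each step raises it by [h], up to a telescoping
   error [h * (density (a i) - 1)]. *)
Lemma euler_u_sum i : h * (K + 1) <= (1 - u) / 2 -> (i <= N.+1)%N ->
  a i <= c /\ i%:R * h <= u_sum k r (a i) <= i%:R * h + h * (density (a i) - 1).
Proof.
have [/andP[u0 u1] Su] := u_spec R k r_gt0.
have c1 : c < 1 by lra.
have uc : u < c by lra.
(* [c] is the midpoint of [u] and 1; [hK] leaves room below [c] for the overshoot [h * K] and one
   further step [h]. *)
move=> hK; elim: i => [|i IHi] iN.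
  split; first by rewrite /=; lra.
  rewrite mul0r add0r u_sum0 lexx mulr_ge0 ?(ltW h_gt0) // subr_ge0 u_density_ge1 //.
  by rewrite lexx ltr01.
have iN' := ltnW iN; have [ac /andP[low up]] := IHi iN'.
have /andP[a0 _] := euler_range R r k.+2 iN'.
have /andP[st1 st2] := euler_step iN'.
have ih1 : i%:R * h <= 1 by rewrite ler_pdivrMr ?ltr0n // mul1r ler_nat.
have a1 : a i < 1 := le_lt_trans ac c1.
have dK : density (a i) <= K by apply: u_density_le.
have hd : h * (density (a i) - 1) <= h * K.
  by rewrite ler_pM2l // lerBlDr; apply: le_trans dK _; rewrite lerDl.
(* The density is at least 1, so [a i] exceeds [u] by no more than [u_sum] at [a i] exceeds 1. *)
have au : a i <= u + h * K.
  have [ua|/ltW au] := leP u (a i); last first.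
    apply: le_trans au _; rewrite lerDl mulr_ge0 ?(ltW h_gt0) // (le_trans ler01) //.
    by apply: u_density_ge1 => //; rewrite c1 (le_trans (ltW u0)) // ltW.
  have /andP[+ _] := u_sum_diff k r_gt0 (ltW u0) ua a1; rewrite Su.
  have : (a i - u) * 1 <= (a i - u) * density u.
    by rewrite ler_wpM2l ?subr_ge0 // u_density_ge1 // u1 ltW.
  move: hd up ih1; move: (h * (_ - 1)) (h * K) (i%:R * h) ((a i - u) * density u).
  by clear => *; lra.
have ac' : a i.+1 <= c.
  move: hK; rewrite mulrDr mulr1; move: au st2.
  by move: h (a i) (a i.+1) (h * K); clear => *; lra.
split=> //.
have a1' : a i.+1 < 1 := le_lt_trans ac' c1.
have := u_sum_diff k r_gt0 a0 st1 a1'; rewrite euler_step_density // => /andP[low' up'].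
have dd : density (a i) <= density (a i.+1) by apply: u_density_le.
(* A step is at most [h], so the loss in the mean value bound is at most the increment of the
   telescoping error. *)
have mid : (a i.+1 - a i) * (density (a i.+1) - density (a i)) <=
    h * (density (a i.+1) - density (a i)) by rewrite ler_wpM2r ?subr_ge0 // lerBlDl.
rewrite -[i.+1%:R]natr1 mulrDl mul1r mulrBr mulr1.
rewrite !mulrBr euler_step_density // in mid; rewrite mulrBr mulr1 in up.
move: low up low' up' mid.
move: h (h * density (a i)) (h * density (a i.+1)) (_ * density (a i.+1)) (i%:R * h).
by clear => *; apply/andP; split; lra.
Qed.

Lemma euler_near_u : h * (K + 1) <= (1 - u) / 2 -> u <= a N.+1 <= u + h * K.
Proof.
have [/andP[u0 u1] Su] := u_spec R k r_gt0.
move=> hK; have [ac] := euler_u_sum hK (leqnn _); rewrite mulfV ?pnatr_eq0 // => /andP[low up].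
have c1 : c < 1 by lra.
have /andP[a0 _] := euler_range R r k.+2 (leqnn N.+1).
have a1 : a N.+1 < 1 := le_lt_trans ac c1.
have ua : u <= a N.+1.
  rewrite leNgt; apply/negP => au; have := u_sum_lt k r_gt0 a0 au u1.
  by rewrite Su ltNge low.
rewrite ua andTb.
have /andP[+ _] := u_sum_diff k r_gt0 (ltW u0) ua a1; rewrite Su.
have : (a N.+1 - u) * 1 <= (a N.+1 - u) * density u.
  by rewrite ler_wpM2l ?subr_ge0 // u_density_ge1 // u1 ltW.
have dK : density (a N.+1) <= K by apply: u_density_le.
have hd : h * (density (a N.+1) - 1) <= h * K.
  by rewrite ler_pM2l // lerBlDr; apply: le_trans dK _; rewrite lerDl.
move: up hd; move: (h * (_ - 1)) (h * K) ((_ - u) * density u).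
by clear => *; lra.
Qed.

(** Antiderivative of [1 - t ^+ r]; its value at [u] is [f]. *)
Let Gam (x : R) : R := x - x ^+ r.+1 / r.+1%:R.

Let Gam_diff x y : 0 <= x -> x <= y -> (y - x) * (1 - y ^+ r) <= Gam y - Gam x <= (y - x) * (1 - x ^+ r).
Proof.
move=> x0 xy; have /andP[] := power_diff_bounds r x0 xy.
have r0 : 0 < r.+1%:R :> R by rewrite ltr0n.
rewrite -!mulrA -ler_pdivlMl // mulrC => l1; rewrite -ler_pdivrMl // => l2.
have -> : Gam y - Gam x = (y - x) - r.+1%:R^-1 * (y ^+ r.+1 - x ^+ r.+1) by rewrite /Gam; ring.
move: l1 l2; rewrite ![_ * (1 - _)]mulrBr !mulr1 [y ^+ r * _]mulrC.
by move: (_ * (_ - _)) => *; lra.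
Qed.

(** The root has one factor more than the slope, so [h] times its summand is an increment of the
    scheme times [1 - a j ^+ r]: a Riemann sum for [Gam] in the variable [a]. *)
Lemma euler_root_near i : (i <= N.+1)%N ->
  Gam (a i) <= h * \sum_(j < i) (1 - a j ^+ r) ^+ k.+2 <= Gam (a i) + h * a i ^+ r.
Proof.
elim: i => [|i IHi] iN.
  by rewrite big_ord0 mulr0 /Gam /= !expr0n /= gtn_eqF // mul0r subr0 mulr0 addr0 lexx.
have iN' := ltnW iN; have /andP[low up] := IHi iN'.
have /andP[a0 a1] := euler_range R r k.+2 iN'.
have /andP[st1 st2] := euler_step iN'.
rewrite big_ord_recr mulrDr.
have -> : h * (1 - a i ^+ r) ^+ k.+2 = (a i.+1 - a i) * (1 - a i ^+ r).
  by rewrite /= addrAC subrr add0r exprSr mulrA.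
have /andP[G1 G2] := Gam_diff a0 st1.
have : (a i.+1 - a i) * (a i.+1 ^+ r - a i ^+ r) <= h * (a i.+1 ^+ r - a i ^+ r).
  by rewrite ler_wpM2r ?lerBlDl // subr_ge0 lerXn2r ?nnegrE // (le_trans a0).
move: low up G1 G2; rewrite !mulrBr !mulr1; set s := h * \sum_(_ < _) _.
move: (a i) (a i.+1) (Gam (a i)) (Gam (a i.+1)) (h * a i ^+ r) (h * a i.+1 ^+ r).
move: ((a i.+1 - a i) * a i ^+ r) ((a i.+1 - a i) * a i.+1 ^+ r) s.
by clear => *; apply/andP; split; lra.
Qed.

Lemma euler_root_f : h * (K + 1) <= (1 - u) / 2 ->
  `|euler_root R r k.+2 N - f R k.+2 r| <= h * (K + 1).
Proof.
have [/andP[u0 u1] Su] := u_spec R k r_gt0.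
move=> /euler_near_u /andP[ua au].
have /andP[] := euler_root_near (leqnn N.+1).
have -> : h * \sum_(j < N.+1) (1 - a j ^+ r) ^+ k.+2 = euler_root R r k.+2 N.
  rewrite /euler_root /root_value /euler_sum; congr (_ * _); apply: eq_bigr => j _.
  by rewrite /tree_step euler_sumE.
have -> : f R k.+2 r = Gam u by [].
have /andP[a0 a1] := euler_range R r k.+2 (leqnn N.+1).
have ar : h * a N.+1 ^+ r <= h by rewrite ler_piMr ?(ltW h_gt0) // exprn_ile1.
have /andP[G1 G2] := Gam_diff (ltW u0) ua.
have G1' : 0 <= (a N.+1 - u) * (1 - a N.+1 ^+ r) by rewrite mulr_ge0 ?subr_ge0 ?exprn_ile1.
have G2' : (a N.+1 - u) * (1 - u ^+ r) <= a N.+1 - u.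
  by rewrite ler_piMr ?subr_ge0 // gerBl exprn_ge0 // ltW.
rewrite mulrDr mulr1 ler_norml; move: G1 G2 G1' G2' ar au ua h_gt0.
move: h (a N.+1) (Gam (a N.+1)) (Gam u) (h * _ ^+ r) (h * K) (euler_root _ _ _ _)
  ((a N.+1 - u) * (1 - a N.+1 ^+ r)) ((a N.+1 - u) * (1 - u ^+ r)).
by clear => *; apply/andP; split; lra.
Qed.

End EulerLimit.

(** * Passage to infinitely many labels, and the theorem *)

Lemma le_of_vanishing_error (R : realType) (x y C D : R) : 0 < D ->
  (forall N : nat, N.+1%:R^-1 <= D -> x <= y + N.+1%:R^-1 * C) -> x <= y.
Proof.
move=> D0 H; apply/ler_addgt0Pr => e e0.
(* For [N.+1] beyond [B], the step is below [D] and the error below [e]. *)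
pose B := D^-1 + `|C| / e.
have B0 : 0 <= B by rewrite addr_ge0 ?invr_ge0 ?divr_ge0 ?(ltW D0) ?(ltW e0).
set N := Num.bound B.
have BN : B < N.+1%:R by apply: lt_le_trans (archi_boundP B0) _; rewrite ler_nat.
have N0 : 0 < N.+1%:R :> R by rewrite ltr0n.
apply: le_trans (H N _) _.
  rewrite -[D]invrK lef_pV2 ?posrE ?invr_gt0 //; apply: le_trans (ltW BN).
  by rewrite lerDl divr_ge0 // ltW.
rewrite lerD2l ler_pdivrMl //; apply: le_trans (ler_norm C) _.
rewrite -ler_pdivrMr //; apply: le_trans (ltW BN).
by rewrite lerDr invr_ge0 ltW.
Qed.

Theorem theorem4 (R : realType) (d r g : nat) (G : hypergraph) :
  (1 <= r)%N -> (2 <= d)%N -> (4 <= g)%N ->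
  uniform G r.+1 -> regular G d -> has_girth G g ->
  [/\ exists! x : R, is_u d r x,
      (f R d r - epsilon R g d r) * #|vertex G|%:R <= greedy_expected_size R G,
      greedy_expected_size R G <= (f R d r + epsilon R g d r) * #|vertex G|%:R
    & (f R d r - epsilon R g d r) * #|vertex G|%:R <= (alpha G)%:R].
Proof.
move=> r0 d2 g4 unifG regG [_ girthG].
case: d d2 regG => [//|[//|k]] _ regG.
have [u01 Su] := u_spec R k r0; have /andP[_ u1] := u01.
(* [m + 1] is the largest depth whose double stays below [g], as disjoint branches require; [m] is
   also the exponent in [epsilon]. *)
pose m := ((g - 1) %/ 2).-1.
have mE : ((g - 1) %/ 2 = m.+1)%N by rewrite /m prednK // divn_gt0 //; lia.
have mE' : ((g - 3) %/ 2 = m)%N by lia.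
have large j : has_berge_cycle G j -> (m.+1.*2 < j)%N by move/girthG; lia.
set K := u_density k r ((1 + u R k.+2 r) / 2).
have K0 : 0 <= K.
  by apply: le_trans ler01 (u_density_ge1 k r0 _); apply/andP; case/andP: u01 => *; split; lra.
set n := #|vertex G|%:R : R.
set E := greedy_expected_size R G; set F := f R k.+2 r; set ep := epsilon R g k.+2 r.
(* The condition on [N] is the smallness needed in [euler_root_f]; the two vanishing errors come
   from ties and from the discretisation. *)
have near N : N.+1%:R^-1 <= (1 - u R k.+2 r) / 2 / (K + 1) ->
    `|E - n * F| <= n * ep + N.+1%:R^-1 * (n * (#|vertex G| ^ 2)%:R + n * (K + 1)).
  rewrite ler_pdivlMr ?ltr_wpDl // => hK.
  have := greedy_near_euler R r0 unifG regG large N; rewrite decay_coefE //.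
  have := euler_root_f r0 hK; rewrite -/F -/K => H1.
  have n0 : 0 <= n by [].
  have := ler_wpM2l n0 H1; rewrite -{1}(ger0_norm n0) -normrM => {}H1.
  rewrite -/E -/n; set e := euler_root _ _ _ _ in H1 *.
  have -> : (k.+2 * (k.+2 - 1) ^ m)%:R / (r%:R * \prod_(1 <= j < m.+2) (j%:R + r%:R^-1)) = ep.
    by rewrite /ep /epsilon mE mE'.
  have -> : E - n * F = (E - n * e) + n * (e - F) by ring.
  move=> H2; apply: le_trans (ler_normD _ _) _; apply: le_trans (lerD H2 H1) _.
  by rewrite le_eqVlt; apply/orP; left; apply/eqP; ring.
have D0 : 0 < (1 - u R k.+2 r) / 2 / (K + 1).
  by rewrite divr_gt0 ?ltr_wpDl // divr_gt0 // subr_gt0.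
have := le_of_vanishing_error D0 near; rewrite ler_norml => /andP[low up].
have lowE : (F - ep) * n <= E by rewrite mulrC mulrBr; move: low; lra.
split.
- have [x [x01 Sx]] := u_exists R k r0; exists x; exact: u_unique.
- exact: lowE.
- by rewrite mulrC mulrDr; move: up; lra.
- by apply: le_trans lowE _; apply: greedy_le_alpha r0 unifG.
Qed.
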